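(* Let $\mathcal{A}_{\mathbb{L}}=\mathbb{C}[\delta_1,\delta_2]Q/(\partial_{x_e}\Phi:e\in E)$ be the deformed noncommutative crepant resolution of the conifold, where $Q$ is the quiver with two vertices, arrows $x,z$ in one direction and arrows $y,w$ in the opposite direction, $E=\{x,y,z,w\}$, and $\Phi=(1+\delta_1)xyzw-(1+\delta_2)wzyx+(\delta_1-\delta_2)zw+(\delta_1-\delta_2)xy$. There exist local noncommutative charts $\mathcal{A}_1$ and $\mathcal{A}_2$ of $\mathcal{A}_{\mathbb{L}}$ which glue into a noncommutative deformation of the resolved conifold. Moreover, the local noncommutative charts are noncommutative deformations of $\mathbb{C}^3$.
   Context: $\partial_{x_e}$ is the cyclic derivative with respect to the arrow $e$; $\delta_1,\delta_2$ are central. A local noncommutative chart of a quiver algebra $\mathcal{A}_{\mathbb{L}}$ is an algebra $\mathcal{A}_i$ (here over $\mathbb{C}[\delta_1,\delta_2]$, with one vertex) together with representations $G_{0i}$ of $\mathcal{A}_i$ over a localization of $\mathcal{A}_{\mathbb{L}}$ at some set of arrows, and $G_{i0}$ of that localization over $\mathcal{A}_i$, which are inverse to each other up to gerbe terms: $G_{ij}\circ G_{ji}(a)=c(h_a)\,a\,c(t_a)^{-1}$ for every arrow $a$ of the quiver of chart $i$, with invertible elements $c(v)$ attached to the vertices $v$ (and similarly with the roles of the two charts exchanged). Here a representation sends vertices to vertices and arrows to elements between the corresponding vertices, respecting the relations. Charts are glued by the transition maps $G_{i0}\circ G_{0j}$ between the corresponding localizations of $\mathcal{A}_j$ and $\mathcal{A}_i$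 (a quiver algebroid stack). A noncommutative deformation of $\mathbb{C}^3$ (resp. of the resolved conifold) here means a noncommutative $\mathbb{C}[\delta_1,\delta_2]$-algebra (resp. two such charts with transition maps) reducing at $\delta_1=\delta_2=0$ to the polynomial ring in three variables (resp. to the standard two-chart affine cover of the resolved conifold $\mathcal{O}_{\mathbb{P}^1}(-1)^{\oplus2}$). *)

(* Defs.v *)
From HB Require Import structures.
From mathcomp Require Import all_boot all_order all_algebra.
From mathcomp Require Import finmap.
From mathcomp Require Import monalg.
From mathcomp Require Import mpoly.
From mathcomp Require Import complex.
From mathcomp Require Import reals.

Set Implicit Arguments.
Unset Strict Implicit.
Unset Printing Implicit Defensive.

Import GRing.Theory.
Local Open Scope ring_scope.

(* K<X>: the basis consists of the words in the alphabet X, multiplied by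
   concatenation. *)
Notation freealg K X := (monalg.malg (monalg.fmonom X) K).

Section FreeAlgebra.
Variable K : comNzRingType.

Definition word (X : choiceType) (s : seq X) : freealg K X :=
  monalg.mkmalgU (monalg.FMonom s) 1.

Definition gen (X : choiceType) (a : X) : freealg K X := word [:: a].

(* The K-algebra morphism K<X> -> K<Y> extending f. *)
Definition subst (X Y : choiceType) (f : X -> freealg K Y) :
    freealg K X -> freealg K Y :=
  monalg.mmap (in_alg (freealg K Y)) (fun m => \prod_(a <- monalg.fmonom_val m) f a).

(* Sum of v u over the factorisations s = u e v. *)
Definition cyclic_deriv_word (X : choiceType) (e : X) (s : seq X) :
    freealg K X :=
  \sum_(i < size s | nth e s i == e) word (drop i.+1 s ++ take i s).

Definition cyclic_deriv (X : choiceType) (e : X) (p : freealg K X) :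
    freealg K X :=
  monalg.mmap (in_alg (freealg K X))
              (fun m => cyclic_deriv_word e (monalg.fmonom_val m)) p.

End FreeAlgebra.

Section QuiverAlgebras.
Variable K : comNzRingType.

(* The quiver algebra K Q / (rels).  A path t -> h is a word a_1 ... a_n with
   tl a_n = t, tl a_i = hd a_{i+1} and hd a_1 = h, i.e. arrows compose like
   functions; the empty word is the trivial path at every vertex.  Thus the
   elements between t and h (the corner e_h (K Q) e_t) are the elements of K<arr>
   supported on paths t -> h, with the multiplication of K<arr>.
   [rels t h r] says that r is one of the relations, between t and h. *)
Record qalg := QAlg {
  vert : finType;
  arr : finType;
  tl : arr -> vert;
  hd : arr -> vert;
  rels : vert -> vert -> freealg K arr -> Prop }.

Fixpoint is_path (A : qalg) (t h : vert A) (s : seq (arr A)) : bool :=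
  if s is a :: s' then (hd a == h) && is_path t (tl a) s' else t == h.

Definition between (A : qalg) (t h : vert A) (p : freealg K (arr A)) : Prop :=
  forall m, m \in monalg.msupp p -> is_path t h (monalg.fmonom_val m).

(* The corner e_h (rels) e_t of the two-sided ideal generated by the
   relations. *)
Inductive ideal (A : qalg) (t h : vert A) : freealg K (arr A) -> Prop :=
| Ideal0 : ideal t h 0
| IdealD u v p r q x : rels u v r -> between v h p -> between t u q ->
    ideal t h x -> ideal t h (p * r * q + x).

(* Equality in K Q / (rels) of two elements between t and h. *)
Definition eqq (A : qalg) (t h : vert A) (p q : freealg K (arr A)) : Prop :=
  ideal t h (p - q).

Record qmap (A B : qalg) := QMap {
  onv : vert A -> vert B;
  ona : arr A -> freealg K (arr B) }.

Definition eval (A B : qalg) (f : qmap A B) :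
  freealg K (arr A) -> freealg K (arr B) := subst (ona f).

(* f is a representation of A over B. *)
Definition is_rep (A B : qalg) (f : qmap A B) : Prop :=
  (forall a, between (onv f (tl a)) (onv f (hd a)) (ona f a)) /\
  (forall t h r, rels t h r -> ideal (onv f t) (onv f h) (eval f r)).

Definition qid (A : qalg) : qmap A A := QMap id (fun a => gen K a).

Definition qcomp (A B C : qalg) (g : qmap B C) (f : qmap A B) : qmap A C :=
  QMap (onv g \o onv f) (eval g \o ona f).

Definition eqmap (A B : qalg) (f g : qmap A B) : Prop :=
  (forall v, onv f v = onv g v) /\
  (forall a, eqq (onv f (tl a)) (onv f (hd a)) (ona f a) (ona g a)).

Definition inverse_pair (A : qalg) (t h : vert A) (p q : freealg K (arr A)) :=
  [/\ between t h p, between h t q, eqq h h (p * q) 1 & eqq t t (q * p) 1].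

(* Localization at a set S of arrows: a formal inverse [inr a] is adjoined for
   every a in S. *)
Section Localization.
Variables (A : qalg) (S : {set arr A}).

Definition loc_arr : finType := (arr A + {a : arr A | a \in S})%type.

Definition loc_tl (b : loc_arr) : vert A :=
  match b with inl a => tl a | inr a => hd (val a) end.

Definition loc_hd (b : loc_arr) : vert A :=
  match b with inl a => hd a | inr a => tl (val a) end.

Definition loc_old (a : arr A) : freealg K loc_arr := gen K (inl a : loc_arr).
Definition loc_inv (a : {a : arr A | a \in S}) : freealg K loc_arr :=
  gen K (inr a : loc_arr).

Inductive loc_rels : vert A -> vert A -> freealg K loc_arr -> Prop :=
| LocOld t h r : rels t h r -> loc_rels t h (subst loc_old r)
| LocInvR a : loc_rels (hd (val a)) (hd (val a))
                       (loc_old (val a) * loc_inv a - 1)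
| LocInvL a : loc_rels (tl (val a)) (tl (val a))
                       (loc_inv a * loc_old (val a) - 1).

Definition loc : qalg := QAlg loc_tl loc_hd loc_rels.

Definition to_loc : qmap A loc := @QMap A loc id loc_old.

End Localization.

Definition loc_loc_arr (A : qalg) (S S' : {set arr A}) (sS : S \subset S')
    (b : loc_arr S) : loc_arr S' :=
  match b with
  | inl a => inl a
  | inr a => inr (exist _ (val a) (subsetP sS _ (valP a)))
  end.

Definition loc_loc (A : qalg) (S S' : {set arr A}) (sS : S \subset S') :
    qmap (loc S) (loc S') :=
  @QMap (loc S) (loc S') id (fun b => gen K (loc_loc_arr sS b)).

(* c v, with inverse c' v, conjugate the composite of g : A -> B and
   f : B -> A into the identity of A. *)
Definition gerbe_inverse (A B : qalg) (f : qmap B A) (g : qmap A B)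
    (c c' : vert A -> freealg K (arr A)) : Prop :=
  (forall v, inverse_pair v (onv f (onv g v)) (c v) (c' v)) /\
  (forall a : arr A,
     eqq (onv f (onv g (tl a))) (onv f (onv g (hd a)))
         (eval f (ona g a)) (c (hd a) * gen K a * c' (tl a))).

Record chart (A0 : qalg) := Chart {
  alg : qalg;
  pt : vert alg;
  pt_only : forall v : vert alg, v = pt;
  locus : {set arr A0};
  G0i : qmap alg (loc locus);
  Gi0 : qmap (loc locus) alg;
  G0i_rep : is_rep G0i;
  Gi0_rep : is_rep Gi0;
  gerbe0 : vert A0 -> freealg K (arr (loc locus));
  gerbe0V : vert A0 -> freealg K (arr (loc locus));
  gerbei : vert alg -> freealg K (arr alg);
  gerbeiV : vert alg -> freealg K (arr alg);
  gerbe0P : gerbe_inverse G0i Gi0 gerbe0 gerbe0V;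
  gerbeiP : gerbe_inverse Gi0 G0i gerbei gerbeiV }.

Arguments gerbe0 {A0} U v : rename.
Arguments gerbei {A0} U v : rename.

(* A quiver algebroid stack over one open set: representations G i j of P j
   over P i and invertible gerbe terms c i j k, with inverses cV.  The cocycle
   condition is c_ijk(G_kl v) c_ikl(v) = G_ij(c_jkl(v)) c_ijl(v). *)
Record stack (I : Type) (P : I -> qalg) := Stack {
  G : forall i j, qmap (P j) (P i);
  c : forall i j k, vert (P k) -> freealg K (arr (P i));
  cV : forall i j k, vert (P k) -> freealg K (arr (P i));
  G_rep : forall i j, is_rep (G i j);
  G_refl : forall i, G i i = qid (P i);
  c_inv : forall i j k (v : vert (P k)),
    inverse_pair (onv (G i k) v) (onv (G i j) (onv (G j k) v))
                 (c i j v) (cV i j v);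
  c_reflL : forall i k (v : vert (P k)),
    eqq (onv (G i k) v) (onv (G i k) v) (c i i v) 1;
  c_reflR : forall i k (v : vert (P k)),
    eqq (onv (G i k) v) (onv (G i k) v) (c i k v) 1;
  c_conj : forall i j k (a : arr (P k)),
    eqq (onv (G i j) (onv (G j k) (tl a))) (onv (G i j) (onv (G j k) (hd a)))
        (eval (G i j) (ona (G j k) a))
        (c i j (hd a) * ona (G i k) a * cV i j (tl a));
  c_cocycle : forall i j k l (v : vert (P l)),
    eqq (onv (G i l) v) (onv (G i j) (onv (G j k) (onv (G k l) v)))
        (c i j (onv (G k l) v) * c i k v)
        (eval (G i j) (c j k v) * c i j v) }.

Arguments G {I P} s i j : rename.
Arguments c {I P} s i j k v : rename.

(* The representations and gerbe terms H0i, Hi0, d0, di between the further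
   localizations of A0 and of the chart restrict those of the chart. *)
Definition restricts_chart (A0 : qalg) (U : chart A0) (S : {set arr A0})
    (sS : locus U \subset S) (T : {set arr (alg U)})
    (H0i : qmap (loc T) (loc S)) (Hi0 : qmap (loc S) (loc T))
    (d0 : vert A0 -> freealg K (arr (loc S)))
    (di : vert (alg U) -> freealg K (arr (loc T))) : Prop :=
  [/\ eqmap (qcomp H0i (to_loc T)) (qcomp (loc_loc sS) (G0i U)),
      eqmap (qcomp Hi0 (loc_loc sS)) (qcomp (to_loc T) (Gi0 U)),
      forall v, eqq (A := loc S) v (onv H0i (onv Hi0 v))
                    (d0 v) (eval (loc_loc sS) (gerbe0 U v))
    & forall v, eqq (A := loc T) v (onv Hi0 (onv H0i v))
                    (di v) (eval (to_loc T) (gerbei U v))].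

Variant three := ch0 | ch1 | ch2.

Definition overlap (A0 : qalg) (U1 U2 : chart A0)
    (T1 : {set arr (alg U1)}) (T2 : {set arr (alg U2)}) (i : three) : qalg :=
  match i with
  | ch0 => loc (locus U1 :|: locus U2)
  | ch1 => loc T1
  | ch2 => loc T2
  end.

(* Over the overlap, charts 1 and 2 are compared through chart 0. *)
Record gluing (A0 : qalg) (U1 U2 : chart A0) := Gluing {
  ov1 : {set arr (alg U1)};
  ov2 : {set arr (alg U2)};
  glue : stack (overlap ov1 ov2);
  glue1 : restricts_chart (subsetUl (locus U1) (locus U2))
    (G glue ch0 ch1) (G glue ch1 ch0)
    (c glue ch0 ch1 ch0) (c glue ch1 ch0 ch1);
  glue2 : restricts_chart (subsetUr (locus U1) (locus U2))
    (G glue ch0 ch2) (G glue ch2 ch0)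
    (c glue ch0 ch2 ch0) (c glue ch2 ch0 ch2);
  glue12 : G glue ch1 ch2 = qcomp (G glue ch1 ch0) (G glue ch0 ch2);
  glue21 : G glue ch2 ch1 = qcomp (G glue ch2 ch0) (G glue ch0 ch1) }.

Definition noncommutative (A : qalg) (v : vert A) : Prop :=
  exists p q, [/\ between v v p, between v v q & ~ eqq v v (p * q) (q * p)].

End QuiverAlgebras.

Section Deformations.
Variable R : realType.
Local Notation C := R[i].
Local Notation K := {mpoly C[2]}.
Local Notation poly3 := {mpoly C[3]}.
Local Notation frac3 := {fraction poly3}.

Definition delta1 : K := 'X_ord0.
Definition delta2 : K := 'X_ord_max.

Inductive rels_at0 (A : qalg K) : vert A -> vert A -> freealg K (arr A) -> Prop :=
| At0Old t h r : rels t h r -> rels_at0 t h r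
| At0Delta1 v : rels_at0 v v delta1%:A
| At0Delta2 v : rels_at0 v v delta2%:A.

(* A / (delta1, delta2) *)
Definition at0 (A : qalg K) : qalg K := QAlg (@tl K A) (@hd K A) (@rels_at0 A).

(* For A with the single vertex v, f induces an isomorphism of C-algebras from
   A / (delta1, delta2) onto the subalgebra D of B, where iota is the C-algebra
   structure of B. *)
Definition reduces_onto (A : qalg K) (v : vert A) (B : comNzRingType)
    (iota : {rmorphism C -> B}) (D : B -> Prop) (f : {rmorphism freealg K (arr A) -> B}) :
    Prop :=
  [/\ forall (k : K) p, f (k *: p) = iota k.@[fun=> 0] * f p,
      forall y, D y <-> exists p, f p = y
    & forall p, f p = 0 <-> ideal (A := at0 A) v v p].

Definition reduces_to_C3 (A : qalg K) (v : vert A)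
    (f : {rmorphism freealg K (arr A) -> poly3}) : Prop :=
  reduces_onto v (@mpolyC 3 C) (fun=> True) f.

Definition deformation_C3 (A0 : qalg K) (U : chart A0) : Prop :=
  noncommutative (pt U) /\
  exists f : {rmorphism freealg K (arr (alg U)) -> poly3},
    reduces_to_C3 (pt U) f.

(* C[u, u^-1, a, b] inside C(u, a, b), with u = 'X_0. *)
Definition laurent (y : frac3) : Prop :=
  exists (p : poly3) (n : nat), y = tofrac p / tofrac 'X_ord0 ^+ n.

Definition reduces_to_overlap (A : qalg K) (v : vert A)
    (f : {rmorphism freealg K (arr A) -> frac3}) : Prop :=
  reduces_onto v (@tofrac poly3 \o @mpolyC 3 C) laurent f.

(* Total space of O(-1) + O(-1) over P^1, with chart coordinates (u, a, b):
   the coordinates of the other chart are u^-1, u a and u b. *)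
Definition std_coord (i : 'I_3) : frac3 :=
  if i == ord0 then (tofrac 'X_ord0)^-1 else tofrac ('X_ord0 * 'X_i).

Definition std_transition (p : poly3) : frac3 :=
  mpoly.mmap (@tofrac poly3 \o @mpolyC 3 C) std_coord p.

Definition deformation_resolved_conifold (A0 : qalg K) (U1 U2 : chart A0)
    (g : gluing U1 U2) : Prop :=
  [/\ noncommutative (pt U1), noncommutative (pt U2) &
  exists (f1 : {rmorphism freealg K (arr (alg U1)) -> poly3})
         (f2 : {rmorphism freealg K (arr (alg U2)) -> poly3})
         (h1 : {rmorphism freealg K (arr (loc (ov1 g))) -> frac3})
         (h2 : {rmorphism freealg K (arr (loc (ov2 g))) -> frac3}),
  [/\ [/\ reduces_to_C3 (pt U1) f1, reduces_to_C3 (pt U2) f2,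
          reduces_to_overlap (A := loc (ov1 g)) (pt U1) h1
        & reduces_to_overlap (A := loc (ov2 g)) (pt U2) h2],
      (forall p, h1 (eval (to_loc (ov1 g)) p) = tofrac (f1 p)),
      (forall p, h2 (eval (to_loc (ov2 g)) p) = tofrac (f2 p)),
      (forall p, h1 (eval (G (glue g) ch1 ch2) (eval (to_loc (ov2 g)) p))
                 = std_transition (f2 p))
    & (forall p, h2 (eval (G (glue g) ch2 ch1) (eval (to_loc (ov1 g)) p))
                 = std_transition (f1 p))]].

End Deformations.

(* The arrows x, z go from [false] to [true], the arrows y, w back. *)
Variant conifold_arrow := ax | ay | az | aw.

Definition conifold_arrow_code (e : conifold_arrow) : bool * bool :=
  match e with
  | ax => (false, false) | ay => (true, false)
  | az => (false, true) | aw => (true, true)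
  end.

Definition conifold_arrow_decode (b : bool * bool) : conifold_arrow :=
  match b with
  | (false, false) => ax | (true, false) => ay
  | (false, true) => az | (true, true) => aw
  end.

Lemma conifold_arrow_codeK : cancel conifold_arrow_code conifold_arrow_decode.
Proof. by case. Qed.

HB.instance Definition _ :=
  Finite.copy conifold_arrow (can_type conifold_arrow_codeK).

Definition conifold_tl (e : conifold_arrow) : bool :=
  match e with ax | az => false | ay | aw => true end.

Definition conifold_hd (e : conifold_arrow) : bool := ~~ conifold_tl e.

Section Conifold.
Variable R : realType.
Local Notation K := {mpoly R[i][2]}.
Local Notation x := (gen K ax).
Local Notation y := (gen K ay).
Local Notation z := (gen K az).
Local Notation w := (gen K aw).
Local Notation d1 := (delta1 R).
Local Notation d2 := (delta2 R).

Definition conifold_potential : freealg K conifold_arrow :=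
  (1 + d1) *: (x * y * z * w) - (1 + d2) *: (w * z * y * x)
  + (d1 - d2) *: (z * w) + (d1 - d2) *: (x * y).

Inductive conifold_rels : bool -> bool -> freealg K conifold_arrow -> Prop :=
| ConifoldRel e : conifold_rels (conifold_hd e) (conifold_tl e)
                                (cyclic_deriv e conifold_potential).

Definition conifold : qalg K := QAlg conifold_tl conifold_hd conifold_rels.

End Conifold.

(* Main.v *)
Require Import Defs.
From HB Require Import structures.
From mathcomp Require Import all_boot all_order all_algebra.
From mathcomp Require Import finmap monalg complex reals.

(** Why the conifold algebra is glued from two deformations of C^3.

    Inverting the arrow x identifies the two vertices, so that nothing is lost
    by putting x = 1.  What remains is an algebra with one vertex, generated by
    u = z, y and w, in which the derivatives of Phi by y, z and w read, with d1
    and d2 for delta1 and delta2,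
      (1 + d1) u w = (1 + d2) w u - (d1 - d2),
      (1 + d1) w y = (1 + d2) y w - (d1 - d2) w,
      (1 + d1) y u = (1 + d2) u y - (d1 - d2) u.
    At d1 = d2 = 0 they say that u, y and w commute: this is a deformation of
    C^3.  Inverting z and putting z = 1 gives the other chart, with u = x.

    Putting x = 1 is a representation F of the localized conifold algebra over
    the chart.  Its inverse E, up to gerbe terms, multiplies every arrow by x or
    x^-1 at its ends to make it a loop at the tail of x.  Then F E is the
    identity, and E F maps an arrow a to g(h_a) a g(t_a)^-1, where g is x^-1 at
    the head of x and 1 at its tail.  Such a conjugation of arrows is one of all
    paths, because the inner factors telescope ([eqq_natural]); hence E F
    preserves the ideal of relations, and E respects the relations without any
    computation ([ideal_coord]).

    A pair (E, F) of this kind is called a retract below.  Retracts of one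
    algebra always form a quiver algebroid stack, with transition maps
    G_ij = F_i E_j and gerbe terms c_ijk(v) = F_i(g_j(E_k v)): the axioms are
    instances of the naturality of conjugation ([star_stack]).  The conifold
    algebra localized at x and z retracts onto both charts with u inverted, and
    this is the gluing; the transition map sends u, y, w to u^-1, y u, w u.

    The charts are noncommutative because all coefficients of the relations
    vanish at d1 = d2 = -1, so that any matrices may be substituted for the letters
    ([chart_noncommutative]).  In the fibre at d1 = d2 = 0 the letters commute, so
    that every word equals an ordered monomial; therefore the evident map to
    C[u, y, w] has no kernel beyond the relations ([chart_normal_form]).  On the
    overlap, multiplying by a power of u clears all letters u^-1 because u commutes
    with the other letters, which reduces the kernel there to the kernel on the
    chart ([clear_denominators]). *)

Set Implicit Arguments.
Unset Strict Implicit.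
Unset Printing Implicit Defensive.

Import GRing.Theory.
Local Open Scope fset_scope.
Local Open Scope ring_scope.

(** * Free algebras and their morphisms *)

Definition wprod (X : choiceType) (S : nzRingType) (h : X -> S)
  (m : fmonom X) : S := \prod_(a <- fmonom_val m) h a.

Lemma wprod_mmorphism (X : choiceType) (S : nzRingType) (h : X -> S) :
  mmorphism (wprod h).
Proof.
by split=> [m1 m2|]; rewrite /wprod ?fmM ?big_cat // fm1 big_nil.
Qed.

HB.instance Definition _ (X : choiceType) (S : nzRingType) (h : X -> S) :=
  isMultiplicative.Build (fmonom X) S (wprod h) (wprod_mmorphism h).

Section FreeAlgebra.
Variable K : comNzRingType.
Implicit Types X Y Z : choiceType.

Lemma word_nil X : word K [::] = 1 :> freealg K X.
Proof. by rewrite /word -fmoneE. Qed.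

Lemma word_cat X (s t : seq X) : word K (s ++ t) = word K s * word K t.
Proof. by rewrite [RHS]fgmulUU mulr1 /word /mmul /= fmmulE. Qed.

Lemma word_cons X (a : X) s : word K (a :: s) = gen K a * word K s.
Proof. by rewrite -word_cat. Qed.

Lemma gen2_word X (a b : X) : gen K a * gen K b = word K [:: a; b].
Proof. by rewrite -word_cat. Qed.

Lemma gen4_word X (a b c d : X) :
  gen K a * gen K b * gen K c * gen K d = word K [:: a; b; c; d].
Proof. by rewrite -word_cat -word_cat -word_cat. Qed.

Lemma free_scaleE X (k : K) (m : fmonom X) :
  << k *g m >> = k *: word K (fmonom_val m).
Proof.
apply/malgP=> m'; rewrite mcoeffZ !mcoeffU.
by case: m => s /=; case: eqP => _; rewrite ?mulr1 ?mulr0.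
Qed.

Lemma freeE X (p : freealg K X) :
  p = \sum_(m <- msupp p) p@_m *: word K (fmonom_val m).
Proof. by rewrite [LHS]monalgE; apply: eq_bigr => m _; exact: free_scaleE. Qed.

Lemma free_ind X (P : freealg K X -> Prop) : P 0 ->
    (forall k s p, P p -> P (k *: word K s + p)) -> forall p, P p.
Proof.
move=> P0 PD p; rewrite [p]freeE; elim: (enum_fset _) => [|m r IH].
  by rewrite big_nil.
by rewrite big_cons; apply: PD.
Qed.

Lemma free_scalerAr X (k : K) (p q : freealg K X) : k *: (p * q) = p * (k *: q).
Proof.
apply/malgP => m; rewrite mcoeffZ.
apply: etrans (congr1 _ (mcoeffMlw m (fsubset_refl _) (fsubset_refl _))) _.
apply: etrans _ (esym (mcoeffMlw m (fsubset_refl _) (msuppZ_le k q))).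
rewrite mulr_sumr; apply: eq_bigr => m1 _; rewrite mulr_sumr.
by apply: eq_bigr => m2 _; rewrite mcoeffZ mulrCA mulrnAr.
Qed.

Lemma in_alg_central X (k : K) (p : freealg K X) :
  GRing.comm (in_alg (freealg K X) k) p.
Proof. by rewrite /GRing.comm /= mulr_algl -free_scalerAr mulr1. Qed.

Section Lift.
Variables (X : choiceType) (S : nzRingType) (sigma : {rmorphism K -> S}).
Variable h : X -> S.
Hypothesis sigma_central : forall k x, GRing.comm (sigma k) x.

Definition lift : freealg K X -> S := monalg.mmap sigma (wprod h).

Lemma lift_word s : lift (word K s) = \prod_(a <- s) h a.
Proof. by rewrite /lift /word mmapU /= rmorph1 mul1r. Qed.

Lemma lift_gen a : lift (gen K a) = h a.
Proof. by rewrite lift_word big_seq1. Qed.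

Lemma liftZ k p : lift (k *: p) = sigma k * lift p.
Proof. exact: mmapZ. Qed.

Lemma lift_additive : additive lift.
Proof. exact: mmap_is_additive. Qed.

(** Scalars commute with words in the source, so their images have to be central. *)
Lemma lift_multiplicative : multiplicative lift.
Proof. apply: commr_mmap_is_multiplicative => g m m'; exact: sigma_central. Qed.

Definition lift_rmorphism : {rmorphism freealg K X -> S} :=
  HB.pack_for (GRing.RMorphism.type (freealg K X) S) lift
    (GRing.isZmodMorphism.Build _ _ lift lift_additive)
    (GRing.isMonoidMorphism.Build _ _ lift
       (lift_multiplicative.2, lift_multiplicative.1)).

End Lift.
End FreeAlgebra.

Section Subst.
Variable K : comNzRingType.

Section SubstMorphism.
Variables (X Y : choiceType) (f : X -> freealg K Y).

HB.instance Definition _ := GRing.isZmodMorphism.Build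
  (freealg K X) (freealg K Y) (subst f) (lift_additive (in_alg _) f).

Lemma subst_multiplicative : monoid_morphism (subst f).
Proof.
by case: (lift_multiplicative f (@in_alg_central K Y)) => fM f1; split.
Qed.

HB.instance Definition _ := GRing.isMonoidMorphism.Build
  (freealg K X) (freealg K Y) (subst f) subst_multiplicative.

Lemma subst_scalable : scalable (subst f).
Proof. by move=> k p; rewrite [LHS](liftZ (in_alg _)) /= mulr_algl. Qed.

HB.instance Definition _ := GRing.isScalable.Build K
  (freealg K X) (freealg K Y) _ (subst f) subst_scalable.

Lemma subst_gen a : subst f (gen K a) = f a.
Proof. exact: (lift_gen (in_alg _)). Qed.

End SubstMorphism.

Lemma subst_word (X Y : choiceType) (f : X -> seq Y) s :
  subst (fun a => word K (f a)) (word K s) = word K (flatten (map f s)).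
Proof.
elim: s => [|a s IH]; first by rewrite word_nil rmorph1 word_nil.
by rewrite word_cons rmorphM /= subst_gen IH -word_cat.
Qed.

End Subst.

(** * Congruence modulo the relations of a quiver *)

HB.instance Definition _ (K : comNzRingType) (A B : qalg K) (f : qmap A B) :=
  GRing.LRMorphism.copy (eval f) (subst (ona f)).

Lemma eval_gen (K : comNzRingType) (A B : qalg K) (f : qmap A B) a :
  eval f (gen K a) = ona f a.
Proof. exact: subst_gen. Qed.

Section Calculus.
Variables (K : comNzRingType) (A : qalg K).
Implicit Types (a : arr A) (t u v h : vert A).
Implicit Types (p q r : freealg K (arr A)) (s : seq (arr A)).

Lemma is_path_cat t h s1 s2 :
  is_path t h (s1 ++ s2) <-> exists2 v, is_path v h s1 & is_path t v s2.
Proof.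
elim: s1 h => [|a s1 IH] h /=.
  by split=> [ps|[v /eqP->]//]; exists h.
split=> [/andP[-> /IH[v p1 p2]]|[v /andP[-> p1] p2]]; first by exists v.
by apply/IH; exists v.
Qed.

Lemma between0 t h : between t h (0 : freealg K (arr A)).
Proof. by move=> m; rewrite msupp0 in_fset0. Qed.

Lemma between_word t h s : is_path t h s -> between t h (word K s).
Proof. by move=> ps m; rewrite msuppU1 => /fset1P ->. Qed.

Lemma between_is_path t h s : between t h (word K s) -> is_path t h s.
Proof. by move/(_ (FMonom s)); apply; rewrite msuppU1 fset11. Qed.

Lemma between_gen a : between (tl a) (hd a) (gen K a).
Proof. by apply: between_word; rewrite /= !eqxx. Qed.

Lemma between1 t : between t t (1 : freealg K (arr A)).
Proof. by rewrite -word_nil; apply: between_word => /=. Qed.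

Lemma betweenD t h p q : between t h p -> between t h q -> between t h (p + q).
Proof.
move=> bp bq m /(fsubsetP (msuppD_le p q)) /fsetUP[/bp|/bq] //.
Qed.

Lemma betweenZ t h k p : between t h p -> between t h (k *: p).
Proof. by move=> bp m /(fsubsetP (msuppZ_le k p)) /bp. Qed.

Lemma betweenM t v h p q :
  between v h p -> between t v q -> between t h (p * q).
Proof.
move=> bp bq m /msuppM_le[m1 [m2 [/bp m1P /bq m2P ->]]].
by rewrite fmM; apply/is_path_cat; exists v.
Qed.

(** The elements between two vertices are the linear combinations of paths. *)
Lemma between_ind t h (P : freealg K (arr A) -> Prop) : P 0 ->
    (forall k s p, is_path t h s -> between t h p -> P p -> P (k *: word K s + p)) ->
  forall p, between t h p -> P p.
Proof.
move=> P0 PD p bp; suff [] : between t h p /\ P p by [].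
rewrite [p]freeE big_seq.
elim/big_rec: _ => [|m q mp [bq Pq]]; first by split; [exact: between0|].
have ps := bp m mp; split; last exact: PD.
by apply: betweenD => //; apply/betweenZ/between_word.
Qed.

Lemma idealD t h p q : ideal t h p -> ideal t h q -> ideal t h (p + q).
Proof.
move=> + iq; elim=> [|u v p' r q' x ru bp bq ix IH]; first by rewrite add0r.
by rewrite -addrA; apply: IdealD ru bp bq IH.
Qed.

Lemma idealZ t h k p : ideal t h p -> ideal t h (k *: p).
Proof.
elim=> [|u v p' r q' x ru bp bq ix IH]; first by rewrite scaler0; exact: Ideal0.
rewrite scalerDr scalerAl scalerAl.
exact: IdealD ru (betweenZ (k := k) bp) bq IH.
Qed.

Lemma idealN t h p : ideal t h p -> ideal t h (- p).
Proof. by rewrite -scaleN1r; apply: idealZ. Qed.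

Lemma idealMl t v h p q : between v h p -> ideal t v q -> ideal t h (p * q).
Proof.
move=> bp; elim=> [|u w p' r q' x ru bp' bq' ix IH].
  by rewrite mulr0; exact: Ideal0.
rewrite mulrDr mulrA mulrA.
exact: IdealD ru (betweenM bp bp') bq' IH.
Qed.

Lemma idealMr t v h p q : between t v q -> ideal v h p -> ideal t h (p * q).
Proof.
move=> bq; elim=> [|u w p' r q' x ru bp' bq' ix IH].
  by rewrite mul0r; exact: Ideal0.
rewrite mulrDl -mulrA.
exact: IdealD ru bp' (betweenM bq' bq) IH.
Qed.

Lemma ideal_rel t h r : rels t h r -> ideal t h r.
Proof.
move=> rr; have := IdealD rr (between1 h) (between1 t) (Ideal0 _ _).
by rewrite mul1r mulr1 addr0.
Qed.

Lemma eqq_refl t h p : eqq t h p p.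
Proof. by rewrite /eqq subrr; exact: Ideal0. Qed.

Lemma eqq_sym t h p q : eqq t h p q -> eqq t h q p.
Proof. by move/idealN; rewrite opprB. Qed.

Lemma eqq_trans t h q p r : eqq t h p q -> eqq t h q r -> eqq t h p r.
Proof. by move=> pq qr; have := idealD pq qr; rewrite addrA subrK. Qed.

Lemma ideal_eqq t h p q : eqq t h p q -> ideal t h q -> ideal t h p.
Proof. by move=> pq iq; have := idealD pq iq; rewrite subrK. Qed.

Lemma eqqD t h p p' q q' :
  eqq t h p p' -> eqq t h q q' -> eqq t h (p + q) (p' + q').
Proof. by move=> pp qq; have := idealD pp qq; rewrite addrACA -opprD. Qed.

Lemma eqqZ t h k p p' : eqq t h p p' -> eqq t h (k *: p) (k *: p').
Proof. by move/(idealZ k); rewrite scalerBr. Qed.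

Lemma eqqMl t v h p q q' :
  between v h p -> eqq t v q q' -> eqq t h (p * q) (p * q').
Proof. by move=> bp /(idealMl bp); rewrite mulrBr. Qed.

Lemma eqqMr t v h p p' q :
  between t v q -> eqq v h p p' -> eqq t h (p * q) (p' * q).
Proof. by move=> bq /(idealMr bq); rewrite mulrBl. Qed.

Lemma inverse_pair1 t : inverse_pair t t 1 (1 : freealg K (arr A)).
Proof. by split; try exact: between1; rewrite mulr1; exact: eqq_refl. Qed.

Lemma ideal_morph (S : nzRingType) (f : {rmorphism freealg K (arr A) -> S}) t h p :
  (forall u v r, rels u v r -> f r = 0) -> ideal t h p -> f p = 0.
Proof.
move=> f_rel; elim=> [|u v p' r q' x ru _ _ _ IH]; first exact: raddf0.
rewrite (raddfD f) /= IH addr0 (rmorphM f) /= (rmorphM f) /= (f_rel _ _ _ ru).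
by rewrite mulr0 mul0r.
Qed.

Section OneVertex.
Variable pt : vert A.
Hypothesis pt_only : forall v : vert A, v = pt.

Lemma one_vertex_path t h s : is_path t h s.
Proof.
elim: s h => [|a s IH] h /=; first by rewrite (pt_only t) (pt_only h).
by rewrite IH (pt_only h) (pt_only (hd a)) eqxx.
Qed.

Lemma one_vertex_between t h p : between t h p.
Proof. by move=> m _; exact: one_vertex_path. Qed.

Hypothesis letters_commute :
  forall a b, eqq pt pt (word K [:: a; b]) (word K [:: b; a]).

Lemma eqq_word_cat2 s1 s s' s2 : eqq pt pt (word K s) (word K s') ->
  eqq pt pt (word K (s1 ++ s ++ s2)) (word K (s1 ++ s' ++ s2)).
Proof.
move=> e.
have wE l : word K (s1 ++ l ++ s2) = word K s1 * (word K l * word K s2).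
  by rewrite word_cat word_cat.
rewrite wE wE.
exact: eqqMl (@one_vertex_between _ _ _) (eqqMr (@one_vertex_between _ _ _) e).
Qed.

(** Moves the letters of the first word across the second one by one. *)
Lemma word_swap s1 s2 : eqq pt pt (word K (s1 ++ s2)) (word K (s2 ++ s1)).
Proof.
elim: s1 s2 => [|a s1 IH] s2; first by rewrite cats0; exact: eqq_refl.
have := eqq_word_cat2 [:: a] [::] (IH s2).
rewrite 2!cats0 => /eqq_trans; apply=> {IH}.
elim: s2 => [|b s2 IH] /=; first exact: eqq_refl.
apply: eqq_trans (eqq_word_cat2 [::] (s2 ++ s1) (letters_commute a b)) _.
by have := eqq_word_cat2 [:: b] [::] IH; rewrite !cats0.
Qed.

Lemma word_perm s1 s2 : perm_eq s1 s2 -> eqq pt pt (word K s1) (word K s2).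
Proof.
move=> s12; move: (eqq_refl pt pt (word K s1)); move: s12.
apply: (catCA_perm_ind (P := fun s => eqq pt pt (word K s1) (word K s))).
move=> t1 t2 t3 /eqq_trans; apply; rewrite !catA.
exact: (eqq_word_cat2 [::] t3 (word_swap t1 t2)).
Qed.

End OneVertex.

End Calculus.

(** * Representations and conjugation *)

Definition arrows_between (K : comNzRingType) (A B : qalg K) (f : qmap A B) :=
  forall a, between (onv f (tl a)) (onv f (hd a)) (ona f a).

Lemma eval_between (K : comNzRingType) (A B : qalg K) (f : qmap A B) t h p :
    arrows_between f ->
  between t h p -> between (onv f t) (onv f h) (eval f p).
Proof.
move=> f_btw; elim/between_ind => [|k s q ps _ IH].
  by rewrite raddf0; exact: between0.
rewrite raddfD /=; apply: betweenD IH; rewrite linearZ /=; apply: betweenZ.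
elim: s h ps => [|a s IHs] h /=.
  by move/eqP->; rewrite word_nil rmorph1; exact: between1.
case/andP=> /eqP <- /IHs bs; rewrite word_cons rmorphM /=.
by apply: betweenM bs; rewrite eval_gen; exact: f_btw.
Qed.

Section Representations.
Variables (K : comNzRingType) (A B : qalg K) (f : qmap A B).
Hypothesis f_rep : is_rep f.

Lemma eval_ideal t h p : ideal t h p -> ideal (onv f t) (onv f h) (eval f p).
Proof.
elim=> [|u v p' r q' x ru /(eval_between f_rep.1) bp /(eval_between f_rep.1) bq ix IH].
  by rewrite raddf0; exact: Ideal0.
rewrite raddfD /= rmorphM /= rmorphM /=; apply: idealD IH.
exact: idealMr bq (idealMl bp (f_rep.2 _ _ _ ru)).
Qed.

Lemma eval_eqq t h p q :
  eqq t h p q -> eqq (onv f t) (onv f h) (eval f p) (eval f q).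
Proof. by move/eval_ideal; rewrite raddfB. Qed.

Lemma eval_inverse_pair t h p q : inverse_pair t h p q ->
  inverse_pair (onv f t) (onv f h) (eval f p) (eval f q).
Proof.
case=> bp bq pq qp; split; try exact: eval_between f_rep.1 _.
  by have := eval_eqq pq; rewrite rmorphM /= rmorph1.
by have := eval_eqq qp; rewrite rmorphM /= rmorph1.
Qed.

End Representations.

Section Composition.
Variable K : comNzRingType.
Implicit Types A B C : qalg K.

Lemma eval_word A B (f : qmap A B) a s :
  eval f (word K (a :: s)) = ona f a * eval f (word K s).
Proof. by rewrite word_cons rmorphM /= eval_gen. Qed.

(** Uniqueness in the universal property of the free algebra. *)
Lemma free_rmorph_eq (X : choiceType) (S : nzRingType) (sigma : K -> S)
    (phi psi : {rmorphism freealg K X -> S}) :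
    (forall k p, phi (k *: p) = sigma k * phi p) ->
    (forall k p, psi (k *: p) = sigma k * psi p) ->
    (forall a, phi (gen K a) = psi (gen K a)) ->
  phi =1 psi.
Proof.
move=> phiZ psiZ eq_gen; apply: free_ind => [|k s p IH].
  by rewrite (raddf0 phi) (raddf0 psi).
rewrite (raddfD phi) (raddfD psi) /= IH phiZ psiZ; congr (_ * _ + _).
elim: s => [|a s IHs]; first by rewrite word_nil (rmorph1 phi) (rmorph1 psi).
by rewrite word_cons (rmorphM phi) (rmorphM psi) /= eq_gen IHs.
Qed.

Lemma evalZ A B (f : qmap A B) k p :
  eval f (k *: p) = in_alg (freealg K (arr B)) k * eval f p.
Proof. by rewrite [LHS]linearZ /= mulr_algl. Qed.

Lemma eval_comp A B C (g : qmap B C) (f : qmap A B) p :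
  eval (qcomp g f) p = eval g (eval f p).
Proof.
apply: (free_rmorph_eq (phi := eval (qcomp g f)) (psi := eval g \o eval f)
  (sigma := in_alg _)) => [||a]; first exact: evalZ.
  by move=> k q; rewrite /= [eval f _]linearZ /= evalZ.
by rewrite /= 2!eval_gen.
Qed.

Lemma eval_id A p : eval (qid A) p = p.
Proof.
apply: (free_rmorph_eq (phi := eval (qid A)) (psi := idfun)
  (sigma := in_alg _)) => [||a]; first exact: evalZ.
  by move=> k q; rewrite /= mulr_algl.
by rewrite /= eval_gen.
Qed.

Lemma qid_rep A : is_rep (qid A).
Proof.
by split=> [a|t h r rr]; [exact: between_gen | rewrite eval_id; exact: ideal_rel].
Qed.

Lemma qcomp_rep A B C (g : qmap B C) (f : qmap A B) :
  is_rep g -> is_rep f -> is_rep (qcomp g f).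
Proof.
move=> g_rep f_rep; split=> [a|t h r rr].
  exact: (eval_between g_rep.1 (f_rep.1 a)).
by rewrite eval_comp; apply: (eval_ideal g_rep); exact: f_rep.2.
Qed.

End Composition.

Section Naturality.
Variables (K : comNzRingType) (A B : qalg K) (f g : qmap A B).
Variables c cV : vert A -> freealg K (arr B).
Hypotheses (f_btw : arrows_between f) (g_btw : arrows_between g).
Hypothesis c_inv : forall v, inverse_pair (onv g v) (onv f v) (c v) (cV v).
Hypothesis c_conj : forall a, eqq (onv f (tl a)) (onv f (hd a))
  (ona f a) (c (hd a) * ona g a * cV (tl a)).

(** In c(h) g(a_1) cV(.) c(.) g(a_2) cV(.) ... the inner factors cV c cancel, so
    conjugation passes from arrows to paths.  The commuting square, rather than
    the conjugate, is what the cocycle condition of a stack asks for. *)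
Lemma eqq_natural t h p : between t h p ->
  eqq (onv g t) (onv f h) (eval f p * c t) (c h * eval g p).
Proof.
have c_btw v : between (onv g v) (onv f v) (c v) by case: (c_inv v).
elim/between_ind => [|k s q ps bq IH].
  by rewrite 2!raddf0 mul0r mulr0; exact: eqq_refl.
rewrite raddfD /= [eval g _]raddfD /= mulrDl mulrDr; apply: eqqD IH.
rewrite linearZ /= [eval g _]linearZ /= -scalerAl -free_scalerAr.
apply: eqqZ; elim: s h ps {bq} => [|a s IHs] h /=.
  move/eqP->; rewrite word_nil rmorph1 rmorph1 mul1r mulr1; exact: eqq_refl.
case/andP=> /eqP <- ps; rewrite eval_word eval_word -mulrA.
apply: eqq_trans (eqqMl (@f_btw a) (IHs _ ps)) _.
have bgs := eval_between g_btw (between_word ps).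
apply: eqq_trans (eqqMr (betweenM (c_btw _) bgs) (c_conj a)) _.
rewrite -mulrA [cV _ * _]mulrA -mulrA -[in X in eqq _ _ _ X](mul1r (eval g _)).
apply: eqqMl (c_btw _) (eqqMl (@g_btw a) (eqqMr bgs _)).
by case: (c_inv (tl a)).
Qed.

Lemma eqq_conj t h p : between t h p ->
  eqq (onv f t) (onv f h) (eval f p) (c h * eval g p * cV t).
Proof.
move=> bp; have [bc bcV ccV cVc] := c_inv t.
apply: eqq_trans _ (eqqMr bcV (eqq_natural bp)).
have := eqqMl (eval_between f_btw bp) ccV.
by rewrite mulr1 mulrA; apply: eqq_sym.
Qed.

End Naturality.

(** Conjugation with trivial gerbe terms. *)
Lemma eval_eqmap (K : comNzRingType) (A B : qalg K) (f g : qmap A B) t h p :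
    is_rep f -> is_rep g -> eqmap f g -> between t h p ->
  eqq (onv f t) (onv f h) (eval f p) (eval g p).
Proof.
move=> f_rep g_rep [fgv fga] bp.
rewrite -[eval g p]mulr1 -[eval g p]mul1r.
apply: (@eqq_conj _ _ _ f g (fun=> 1) (fun=> 1) f_rep.1 g_rep.1) bp => [v|a].
  by rewrite fgv; exact: inverse_pair1.
by rewrite mul1r mulr1.
Qed.

(** * Retracts and the stacks that they form *)

(** A pair of representations inverse to each other up to gerbe terms, normalized
    so that the gerbe terms live on the side of A only: B is recovered exactly. *)
Record retract (K : comNzRingType) (A B : qalg K) (E : qmap B A) (F : qmap A B)
    (g gV : vert A -> freealg K (arr A)) : Prop := Retract {
  retract_E : is_rep E;
  retract_F : is_rep F;
  retract_gerbe : gerbe_inverse E F g gV;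
  retract_FE : eqmap (qcomp F E) (qid B);
  retract_F1 : forall v, eqq (onv F v) (onv F v) (eval F (g v)) 1;
  retract_g1 : forall v, g (onv E v) = 1 }.

Lemma retract_conj (K : comNzRingType) (A B : qalg K) (E : qmap B A)
    (F : qmap A B) g gV : retract E F g gV -> forall a,
  eqq (onv (qcomp E F) (tl a)) (onv (qcomp E F) (hd a)) (ona (qcomp E F) a)
      (g (hd a) * ona (qid A) a * gV (tl a)).
Proof. by case=> _ _ [_ gP] _ _ _; exact: gP. Qed.

Lemma retract_id (K : comNzRingType) (A : qalg K) :
  retract (qid A) (qid A) (fun=> 1) (fun=> 1).
Proof.
split=> [||||v|//]; try exact: qid_rep; try by rewrite eval_id; exact: eqq_refl.
  split=> [v|a]; first exact: inverse_pair1.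
  by rewrite eval_id mul1r mulr1; exact: eqq_refl.
by split=> [//|a]; rewrite /= eval_id; exact: eqq_refl.
Qed.

Section StarStack.
Variables (K : comNzRingType) (I : Type) (A : qalg K) (P : I -> qalg K).
Variables (E : forall i, qmap (P i) A) (F : forall i, qmap A (P i)).
Variables g gV : I -> vert A -> freealg K (arr A).
Hypothesis EF : forall i, retract (E i) (F i) (g i) (gV i).
Variable T : forall i j, qmap (P j) (P i).
Hypothesis T_rep : forall i j, is_rep (T i j).
Hypothesis T_refl : forall i, T i i = qid (P i).
Hypothesis T_factor : forall i j, eqmap (T i j) (qcomp (F i) (E j)).

(** G_ij G_jk is F_i (E_j F_j) E_k, and E_j F_j is conjugation by g_j. *)
Definition star_gerbe i j k (v : vert (P k)) := eval (F i) (g j (onv (E k) v)).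
Definition star_gerbeV i j k (v : vert (P k)) := eval (F i) (gV j (onv (E k) v)).

Let TE i j v : onv (T i j) v = onv (F i) (onv (E j) v) := (T_factor i j).1 v.
Let F_rep i : is_rep (F i) := retract_F (EF i).
Let E_rep i : is_rep (E i) := retract_E (EF i).

Lemma star_inv i j k (v : vert (P k)) :
  inverse_pair (onv (T i k) v) (onv (T i j) (onv (T j k) v))
               (star_gerbe i j v) (star_gerbeV i j v).
Proof.
by rewrite 3!TE; apply/eval_inverse_pair/(retract_gerbe (EF j)).1/F_rep.
Qed.

Lemma star_reflL i k (v : vert (P k)) :
  eqq (onv (T i k) v) (onv (T i k) v) (star_gerbe i i v) 1.
Proof. by rewrite TE; exact: retract_F1. Qed.

Lemma star_reflR i k (v : vert (P k)) :
  eqq (onv (T i k) v) (onv (T i k) v) (star_gerbe i k v) 1.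
Proof. by rewrite /star_gerbe (retract_g1 (EF k)) rmorph1; exact: eqq_refl. Qed.

(** The conjugation E_j F_j of [retract_conj], applied to E_k(a) and mapped by F_i. *)
Lemma star_conj i j k (a : arr (P k)) :
  eqq (onv (T i j) (onv (T j k) (tl a))) (onv (T i j) (onv (T j k) (hd a)))
      (eval (T i j) (ona (T j k) a))
      (star_gerbe i j (hd a) * ona (T i k) a * star_gerbeV i j (tl a)).
Proof.
have FE_rep := qcomp_rep (F_rep i) (E_rep j).
apply: eqq_trans (eval_eqmap (T_rep i j) FE_rep (T_factor i j)
                             ((T_rep j k).1 a)) _.
rewrite eval_comp 4!TE.
have Ea := (E_rep k).1 a.
have := (T_factor j k).2 a; rewrite 2!TE => /(eval_eqq (E_rep j)).
move/(eval_eqq (F_rep i)) => /eqq_trans; apply.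
have := eqq_conj (qcomp_rep (E_rep j) (F_rep j)).1 (@qid_rep _ _).1
  (retract_gerbe (EF j)).1 (retract_conj (EF j)) Ea.
rewrite eval_comp eval_id => /(eval_eqq (F_rep i)) /eqq_trans; apply.
rewrite rmorphM /= rmorphM /=.
have [_ cV _ _] := star_inv i j (tl a).
have [c _ _ _] := star_inv i j (hd a).
move: c cV; rewrite 6!TE => c cV.
apply: (eqqMr cV); apply: (eqqMl c).
by have := eqq_sym ((T_factor i k).2 a); rewrite 2!TE.
Qed.

(** The naturality square of the conjugation E_j F_j at the element g_k(E_l v),
    mapped by F_i. *)
Lemma star_cocycle i j k l (v : vert (P l)) :
  eqq (onv (T i l) v) (onv (T i j) (onv (T j k) (onv (T k l) v)))
      (star_gerbe i j (onv (T k l) v) * star_gerbe i k v)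
      (eval (T i j) (star_gerbe j k v) * star_gerbe i j v).
Proof.
have [ck _ _ _] := (retract_gerbe (EF k)).1 (onv (E l) v).
have := eqq_natural (qcomp_rep (E_rep j) (F_rep j)).1 (@qid_rep _ _).1
  (retract_gerbe (EF j)).1 (retract_conj (EF j)) ck.
rewrite eval_comp eval_id => /(eval_eqq (F_rep i)).
rewrite [X in eqq _ _ X _]rmorphM [X in eqq _ _ _ X]rmorphM /=.
move/eqq_sym; rewrite 4!TE => /eqq_trans; apply.
have [bj _ _ _] := star_inv i j v; rewrite 3!TE in bj.
apply: eqqMr bj _; rewrite -eval_comp; apply: eqq_sym.
have bFk := eval_between (F_rep j).1 ck.
have := eval_eqmap (T_rep i j) (qcomp_rep (F_rep i) (E_rep j)) (T_factor i j) bFk.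
by rewrite 2!TE.
Qed.

Definition star_stack : stack P :=
  Stack T_rep T_refl star_inv star_reflL star_reflR star_conj star_cocycle.

End StarStack.

(** * Monomial maps and localization *)

Section WordMaps.
Variable K : comNzRingType.

Definition wmap (A B : qalg K) (v : vert A -> vert B)
    (f : arr A -> seq (arr B)) : qmap A B := QMap v (fun a => word K (f a)).

Lemma eval_wmap A B (v : vert A -> vert B) (f : arr A -> seq (arr B)) s :
  eval (wmap v f) (word K s) = word K (flatten (map f s)).
Proof. exact: subst_word. Qed.

Lemma wmap_between A B (v : vert A -> vert B) f :
    (forall a, is_path (v (tl a)) (v (hd a)) (f a)) ->
  arrows_between (@wmap A B v f).
Proof. by move=> f_path a; apply: between_word; exact: f_path. Qed.

End WordMaps.

Section Cancellation.
Variables (K : comNzRingType) (A : qalg K) (S : {set arr A}).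
Implicit Types s : seq (loc_arr S).

(** Two monomials of a localization are compared by free reduction, which turns
    the comparisons of explicit words below into computations. *)
Definition cancels (b c : loc_arr S) : bool :=
  match b, c with
  | inl a, inr a' | inr a', inl a => a == val a'
  | _, _ => false
  end.

Fixpoint reduce s : seq (loc_arr S) :=
  if s is b :: s' then
    if reduce s' is c :: r then if cancels b c then r else b :: c :: r
    else [:: b]
  else [::].

Lemma eqq_cancels b c : cancels b c ->
  loc_tl c = loc_hd b /\
  eqq (A := loc S) (loc_hd b) (loc_hd b) (gen K b * gen K c) 1.
Proof.
case: b c => [a|a] [a'|a'] //= /eqP -> //; split=> //; apply: ideal_rel.
  exact: LocInvR.
exact: LocInvL.
Qed.

Lemma reduceP (t h : vert (loc S)) s : is_path (A := loc S) t h s ->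
  is_path (A := loc S) t h (reduce s) /\
  eqq (A := loc S) t h (word K s) (word K (reduce s)).
Proof.
elim: s h => [|b s IH] h /=; first by split=> //; exact: eqq_refl.
case/andP=> /eqP <- /IH[+ er].
have btw_b : between (A := loc S) (tl (b : arr (loc S))) (loc_hd b) (gen K b).
  exact: between_gen.
have := eqqMl btw_b er; case: (reduce s) => [|c r] {er IH} er pr.
  split; first by rewrite /= eqxx; exact: pr.
  by rewrite -word_cons -word_cons in er.
case: ifP => [/eqq_cancels[/= cb e1]|_]; last first.
  split; first by rewrite /= eqxx; exact: pr.
  by rewrite -word_cons -word_cons in er.
move: pr => /= /andP[_ pr]; rewrite [loc_tl c]cb in pr.
split; first exact: pr.
rewrite word_cons; apply: eqq_trans er _.
rewrite word_cons mulrA -[X in eqq _ _ _ X]mul1r.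
by apply: eqqMr e1; exact: between_word.
Qed.

Lemma eqq_word (t h : vert (loc S)) s1 s2 :
    is_path (A := loc S) t h s1 -> is_path (A := loc S) t h s2 ->
    reduce s1 == reduce s2 ->
  eqq (A := loc S) t h (word K s1) (word K s2).
Proof.
move=> /reduceP[_ e1] /reduceP[_ e2] /eqP e12; apply: eqq_trans e1 _.
by rewrite e12; apply: eqq_sym.
Qed.

End Cancellation.

Lemma eqmap_words (K : comNzRingType) (A B : qalg K) (f g : qmap A B)
    (vf : onv f =1 onv g) :
  (forall a, ona f a = ona g a) -> eqmap f g.
Proof. by move=> fg; split=> // a; rewrite fg; exact: eqq_refl. Qed.

Section EqmapTheory.
Variables (K : comNzRingType) (A B : qalg K).
Implicit Types f g : qmap A B.

Lemma eqmap_refl f : eqmap f f.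
Proof. exact: eqmap_words. Qed.

Lemma eqmap_sym f g : eqmap f g -> eqmap g f.
Proof. by case=> fgv fga; split=> // a; rewrite -2!fgv; exact: eqq_sym. Qed.

Lemma eqmap_idl f : eqmap f (qcomp (qid B) f).
Proof. by apply: eqmap_words => // a; rewrite [RHS]eval_id. Qed.

Lemma eqmap_idr f : eqmap f (qcomp f (qid A)).
Proof. by apply: eqmap_words => // a; rewrite [RHS]eval_gen. Qed.

End EqmapTheory.

Section RetractWords.
Variables (K : comNzRingType) (A B : qalg K) (S : {set arr A}).
Variables (vE : vert B -> vert A) (fE : arr B -> seq (loc_arr S)).
Variables (vF : vert A -> vert B) (fF : loc_arr S -> seq (arr B)).
Variables w wV : vert A -> seq (loc_arr S).

(** When all maps send arrows to words, the axioms of a retract other than the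
    relations are identities between reduced words. *)
Lemma retract_words :
    is_rep (wmap (B := loc S) vE fE) -> is_rep (wmap (A := loc S) vF fF) ->
    (forall v, [&& is_path (A := loc S) v (vE (vF v)) (w v),
                   is_path (A := loc S) (vE (vF v)) v (wV v),
                   reduce (w v ++ wV v) == [::] & reduce (wV v ++ w v) == [::]]) ->
    (forall a : loc_arr S, reduce (flatten (map fE (fF a)))
                        == reduce (w (loc_hd a) ++ a :: wV (loc_tl a))) ->
    (forall v, vF (vE v) = v) ->
    (forall a, flatten (map fF (fE a)) = [:: a]) ->
    (forall v, flatten (map fF (w v)) = [::]) ->
    (forall v, w (vE v) = [::]) ->
  retract (wmap (B := loc S) vE fE) (wmap (A := loc S) vF fF)
          (fun v => word K (w v)) (fun v => word K (wV v)).
Proof.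
move=> E_rep F_rep wP conj FEv FEa Fw wE.
have path_w v : is_path (A := loc S) v (vE (vF v)) (w v) by case/and4P: (wP v).
have path_wV v : is_path (A := loc S) (vE (vF v)) v (wV v) by case/and4P: (wP v).
split; [exact: E_rep | exact: F_rep | | | move=> v | move=> v].
- split=> [v|a].
    case/and4P: (wP v) => _ _ e1 e2.
    split; [exact: between_word | exact: between_word | |].
      rewrite -word_cat -word_nil; apply: eqq_word => //=.
      by apply/is_path_cat; exists v.
    rewrite -word_cat -word_nil; apply: eqq_word => //=.
    by apply/is_path_cat; exists (vE (vF v)).
  rewrite [eval _ _]eval_wmap -word_cat -word_cat -catA; apply: eqq_word (conj a).
    by have := eval_between E_rep.1 (F_rep.1 a); rewrite eval_wmap => /between_is_path.
  apply/is_path_cat; exists (loc_hd a) => //=.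
  by rewrite eqxx; exact: path_wV.
- apply: eqmap_words => // a; rewrite /= -/(gen _ _).
  by rewrite [eval _ _]eval_wmap FEa.
- by rewrite [eval _ _]eval_wmap Fw word_nil; exact: eqq_refl.
by rewrite /= wE word_nil.
Qed.

End RetractWords.

Section ChartOfRetract.
Variables (K : comNzRingType) (A0 B : qalg K) (S : {set arr A0}).
Variables (E : qmap B (loc S)) (F : qmap (loc S) B).
Variables g gV : vert A0 -> freealg K (arr (loc S)).
Hypothesis EF : retract E F g gV.
Variables (p : vert B) (p_only : forall v : vert B, v = p).

Lemma retract_gerbei : gerbe_inverse F E (fun=> 1) (fun=> 1).
Proof.
have [FEv FEa] := retract_FE EF; split=> [v|a].
  by rewrite [onv F _]FEv; exact: inverse_pair1.
by rewrite mul1r mulr1; exact: FEa.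
Qed.

Definition retract_chart : chart A0 :=
  Chart p_only (retract_E EF) (retract_F EF) (retract_gerbe EF) retract_gerbei.

End ChartOfRetract.

Section LocalizationMaps.
Variable K : comNzRingType.

Lemma subst_comp (X Y Z : choiceType) (g : Y -> freealg K Z)
    (f : X -> freealg K Y) p :
  subst g (subst f p) = subst (fun a => subst g (f a)) p.
Proof.
apply: (free_rmorph_eq (phi := subst g \o subst f)
  (psi := subst (fun a => subst g (f a))) (sigma := in_alg _)) => [k q|k q|a].
- by rewrite /= [subst f _]linearZ /= [LHS]linearZ /= mulr_algl.
- by rewrite [LHS]linearZ /= mulr_algl.
by rewrite /= subst_gen subst_gen.
Qed.

Lemma eq_subst (X Y : choiceType) (f g : X -> freealg K Y) p :
  f =1 g -> subst f p = subst g p.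
Proof.
move=> fg; apply: (free_rmorph_eq (phi := subst f) (psi := subst g)
  (sigma := in_alg _)) => [k q|k q|a].
- by rewrite [LHS]linearZ /= mulr_algl.
- by rewrite [LHS]linearZ /= mulr_algl.
by rewrite /= subst_gen subst_gen.
Qed.

(** Universal property of the localization, for maps sending arrows to words. *)
Lemma loc_wmap_rep (A B : qalg K) (S : {set arr A}) (v : vert A -> vert B)
    (f : loc_arr S -> seq (arr B)) :
    (forall a, is_path (v (loc_tl a)) (v (loc_hd a)) (f a)) ->
    (forall t h r, rels t h r ->
       ideal (v t) (v h) (subst (fun a => word K (f (inl a))) r)) ->
    (forall a : {a | a \in S},
       eqq (v (hd (val a))) (v (hd (val a)))
           (word K (f (inl (val a)) ++ f (inr a))) (word K [::])) ->
    (forall a : {a | a \in S},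
       eqq (v (tl (val a))) (v (tl (val a)))
           (word K (f (inr a) ++ f (inl (val a)))) (word K [::])) ->
  is_rep (wmap (A := loc S) v f).
Proof.
move=> f_path f_rel f_invR f_invL; split; first exact: wmap_between.
have evalM b c : eval (wmap (A := loc S) v f) (gen K b * gen K c - 1) =
    word K (f b ++ f c) - word K [::].
  apply: etrans (raddfB _ _ _) _; congr (_ - _); last by rewrite /= rmorph1 word_nil.
  by rewrite gen2_word [LHS]eval_wmap /= cats0.
move=> t h _ [{}t {}h r|a|a]; last 2 first.
- by rewrite evalM; exact: f_invR.
- by rewrite evalM; exact: f_invL.
move=> rr; suff -> : eval (wmap (A := loc S) v f) (subst (@loc_old K A S) r) =
    subst (fun a => word K (f (inl a))) r by exact: f_rel.
apply: etrans (subst_comp _ _ _) (eq_subst _ _) => a; exact: subst_gen.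
Qed.

End LocalizationMaps.

(** * The relations of the conifold *)

Section CyclicDerivative.
Variables (K : comNzRingType) (X : choiceType) (e : X).

Lemma cyclic_deriv_linear k (s : seq X) p :
  cyclic_deriv e (k *: word K s + p) = k *: cyclic_deriv_word K e s + cyclic_deriv e p.
Proof.
rewrite /cyclic_deriv raddfD /=; congr (_ + _).
by rewrite -(free_scaleE k (FMonom s)) mmapU /= mulr_algl.
Qed.

Definition cyclic_words (s : seq X) : seq (seq X) :=
  [seq drop i.+1 s ++ take i s | i <- iota 0 (size s) & nth e s i == e].

Lemma cyclic_deriv_wordE s :
  cyclic_deriv_word K e s = \sum_(t <- cyclic_words s) word K t.
Proof.
rewrite /cyclic_deriv_word big_map big_filter -[X in iota 0 X]subn0.
by rewrite -/(index_iota 0 (size s)) big_mkord.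
Qed.

(** A potential of the shape of Phi, with arrows occurring once in each quartic
    term and once in the sum of the quadratic terms. *)
Lemma cyclic_deriv_quartic (k1 k2 k3 : K) (s1 s2 s3 s4 t1 t2 t3 : seq X)
    p1 p2 p3 p4 :
    p1 = word K s1 -> p2 = word K s2 -> p3 = word K s3 -> p4 = word K s4 ->
    cyclic_words s1 = [:: t1] -> cyclic_words s2 = [:: t2] ->
    cyclic_words s3 ++ cyclic_words s4 = [:: t3] ->
  cyclic_deriv e (k1 *: p1 - k2 *: p2 + k3 *: p3 + k3 *: p4) =
  k1 *: word K t1 + (- k2) *: word K t2 + k3 *: word K t3.
Proof.
move=> -> -> -> -> e1 e2 e34.
have deriv1 k s : cyclic_deriv e (k *: word K s) = k *: cyclic_deriv_word K e s.
  rewrite -[k *: word K s]addr0 cyclic_deriv_linear.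
  by rewrite [X in _ + X]raddf0 addr0.
have assoc (V : zmodType) (x y z t : V) : x + y + z + t = x + (y + (z + t)).
  by rewrite -!addrA.
rewrite -scaleNr [X in cyclic_deriv e X]assoc cyclic_deriv_linear.
rewrite cyclic_deriv_wordE e1 big_seq1 -addrA; congr (_ + _).
rewrite cyclic_deriv_linear cyclic_deriv_wordE e2 big_seq1; congr (_ + _).
rewrite cyclic_deriv_linear deriv1 -scalerDr; congr (_ *: _).
by rewrite cyclic_deriv_wordE cyclic_deriv_wordE -big_cat e34; apply: big_seq1.
Qed.

End CyclicDerivative.

From mathcomp Require Import mpoly.

Section ConifoldRelations.
Variable R : realType.
Local Notation K := {mpoly R[i][2]}.
Local Notation d1 := (delta1 R).
Local Notation d2 := (delta2 R).

(** The three monomials of the derivative of Phi by an arrow, see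
    [conifold_derivE]. *)
Definition conifold_terms (e : conifold_arrow) :
    seq conifold_arrow * seq conifold_arrow * conifold_arrow :=
  match e with
  | ax => ([:: ay; az; aw], [:: aw; az; ay], ay)
  | ay => ([:: az; aw; ax], [:: ax; aw; az], ax)
  | az => ([:: aw; ax; ay], [:: ay; ax; aw], aw)
  | aw => ([:: ax; ay; az], [:: az; ay; ax], az)
  end.

Lemma conifold_derivE e (t := conifold_terms e) :
  cyclic_deriv e (conifold_potential R) =
  (1 + d1) *: word K t.1.1 + (- (1 + d2)) *: word K t.1.2 + (d1 - d2) *: gen K t.2.
Proof.
by apply: (cyclic_deriv_quartic _ _ _
  (gen4_word K ax ay az aw) (gen4_word K aw az ay ax)
  (gen2_word K az aw) (gen2_word K ax ay)); case: e @t.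
Qed.

Lemma conifold_rel_between e : between (A := conifold R)
  (conifold_hd e) (conifold_tl e) (cyclic_deriv e (conifold_potential R)).
Proof.
rewrite conifold_derivE; apply: betweenD; first apply: betweenD.
- by apply/betweenZ/between_word; case: e.
- by apply/betweenZ/between_word; case: e.
by apply/betweenZ/between_word; case: e.
Qed.

End ConifoldRelations.

(** * The charts *)

(** The arrow that is inverted and put equal to 1: x in the chart [false], z in
    the chart [true]. *)
Definition gauge (b : bool) : conifold_arrow := if b then az else ax.

(** The generators u, y, w of both charts; u is the arrow among x, z that is not
    inverted, and comes first as it is the coordinate on the base P^1. *)
Definition cu : 'I_3 := ord0.
Definition cy : 'I_3 := @Ordinal 3 1 isT.
Definition cw : 'I_3 := ord_max.

Definition contract (b : bool) (a : conifold_arrow) : seq 'I_3 :=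
  match a with
  | ay => [:: cy]
  | aw => [:: cw]
  | _ => if a == gauge b then [::] else [:: cu]
  end.

Definition coordinate (b : bool) (i : 'I_3) : conifold_arrow :=
  match val i with 0 => gauge (~~ b) | 1 => ay | _ => aw end.

Section Charts.
Variable R : realType.
Local Notation K := {mpoly R[i][2]}.
Local Notation A := (conifold R).

(** The relations of the conifold with the inverted arrow put equal to 1. *)
Definition chart_rels (b : bool) (t h : unit) (r : freealg K 'I_3) : Prop :=
  exists e, r = subst (fun a => word K (contract b a))
                      (cyclic_deriv e (conifold_potential R)).

Definition chart_alg (b : bool) : qalg K :=
  @QAlg K unit 'I_3 (fun=> tt) (fun=> tt) (chart_rels b).

Section Gauge.
Variables (b : bool) (S : {set conifold_arrow}) (bS : gauge b \in S).
Local Notation locS := (@loc K A S).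

(** The gerbe terms g(v) and their inverses: the loops E(a) start and end at the
    vertex [false], the tail of the inverted arrow. *)
Definition gauge_inv (v : bool) : seq (@loc_arr K A S) :=
  if v then [:: inr (exist _ (gauge b) bS)] else [::].

Definition gauge_fwd (v : bool) : seq (@loc_arr K A S) :=
  if v then [:: inl (gauge b)] else [::].

Definition coord_word (i : 'I_3) : seq (@loc_arr K A S) :=
  let a := coordinate b i in
  gauge_inv (conifold_hd a) ++ inl a :: gauge_fwd (conifold_tl a).

End Gauge.

Section GaugeLemmas.
Variable S : {set conifold_arrow}.
Local Notation locS := (@loc K A S).

Lemma gaugeP b (bS : gauge b \in S) v :
  [&& is_path (A := locS) v false (gauge_inv bS v),
      is_path (A := locS) false v (gauge_fwd b S v),
      reduce (gauge_inv bS v ++ gauge_fwd b S v) == [::]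
    & reduce (gauge_fwd b S v ++ gauge_inv bS v) == [::]].
Proof. by case: b bS v => h []. Qed.

Lemma coord_word_path b (bS : gauge b \in S) i :
  is_path (A := locS) false false (coord_word bS i).
Proof. by case: b bS => h; case: i => [[|[|[|//]]] ?]. Qed.

Lemma coord_word_contract b (bS : gauge b \in S) a :
  reduce (flatten (map (coord_word bS) (contract b a))) ==
  reduce (gauge_inv bS (conifold_hd a) ++ inl a :: gauge_fwd b S (conifold_tl a)).
Proof. by case: b bS => h; case: a. Qed.

(** The map is E F on the relation, hence the relation conjugated by the gerbe
    terms. *)
Lemma ideal_coord b (bS : gauge b \in S) e :
  ideal (A := locS) false false
    (subst (fun i => word K (coord_word bS i))
      (subst (fun a => word K (contract b a))
        (cyclic_deriv e (conifold_potential R)))).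
Proof.
set p := cyclic_deriv _ _.
pose f : qmap A locS :=
  wmap (A := A) (B := locS) (fun=> false)
    (fun a => flatten (map (coord_word bS) (contract b a))).
have f_path a : is_path (A := locS) false false
    (flatten (map (coord_word bS) (contract b a))).
  elim: (contract b a) => [//|i s IH]; apply/is_path_cat; exists false => //.
  exact: coord_word_path.
have -> : subst (fun i => word K (coord_word bS i))
    (subst (fun a => word K (contract b a)) p) = eval f p.
  by apply: etrans (subst_comp _ _ _) (eq_subst _ _) => a; exact: subst_word.
have c_inv v : inverse_pair (A := locS) v false (word K (gauge_inv bS v))
                                                (word K (gauge_fwd b S v)).
  case/and4P: (gaugeP bS v) => p1 p2 e1 e2.
  split; [exact: between_word | exact: between_word | |].
    rewrite -word_cat -word_nil; apply: eqq_word => //.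
    by apply/is_path_cat; exists v.
  rewrite -word_cat -word_nil; apply: eqq_word => //=.
  by apply/is_path_cat; exists false.
have c_conj a : eqq (A := locS) false false (ona f a)
    (word K (gauge_inv bS (conifold_hd a)) * ona (@to_loc K A S) a
     * word K (gauge_fwd b S (conifold_tl a))).
  rewrite /= -/(gen _ _) -word_cat -word_cat -catA.
  apply: eqq_word (f_path a) _ (coord_word_contract bS a).
  apply/is_path_cat; exists (conifold_hd a).
    by case/and4P: (gaugeP bS (conifold_hd a)).
  by rewrite /= eqxx /=; case/and4P: (gaugeP bS (conifold_tl a)).
have to_loc_btw : arrows_between (@to_loc K A S).
  by move=> a; apply: between_word => /=; rewrite !eqxx.
have f_btw : arrows_between f by apply: wmap_between => a; exact: f_path.
apply: ideal_eqq
  (eqq_conj f_btw to_loc_btw c_inv c_conj (@conifold_rel_between R e)) _.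
have [_ bcV _ _] := c_inv (conifold_hd e); apply: idealMr bcV _.
have [bc _ _ _] := c_inv (conifold_tl e); apply: idealMl bc _.
by apply: ideal_rel; apply: (@LocOld K A S _ _ p); exact: ConifoldRel.
Qed.

End GaugeLemmas.
End Charts.

Section Gluing.
Variable R : realType.
Local Notation K := {mpoly R[i][2]}.
Local Notation A := (conifold R).

Section Chart.
Variable b : bool.
Local Notation B := (chart_alg R b).
Local Notation S := [set gauge b].

Definition chart_F_word (a : @loc_arr K A S) : seq 'I_3 :=
  if a is inl a then contract b a else [::].

Definition chart_E : qmap B (loc (A := A) S) :=
  wmap (A := B) (B := loc (A := A) S) (fun=> false) (coord_word R (set11 (gauge b))).
Definition chart_F : qmap (loc (A := A) S) B :=
  wmap (A := loc (A := A) S) (B := B) (fun=> tt) chart_F_word.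

Definition chart_gerbe v := word K (gauge_inv R (set11 (gauge b)) v).
Definition chart_gerbeV v := word K (gauge_fwd R b S v).

End Chart.

Lemma chart_E_rep b : is_rep (chart_E b).
Proof.
split; first by apply: wmap_between => a; exact: coord_word_path.
by move=> t h _ [e ->]; exact: ideal_coord.
Qed.

Lemma unit_only (v : unit) : v = tt.
Proof. by case: v. Qed.

Lemma chart_path b (t h : vert (chart_alg R b)) s : is_path t h s.
Proof. exact: (one_vertex_path (A := chart_alg R b) unit_only). Qed.

Lemma chart_F_rep b : is_rep (chart_F b).
Proof.
apply: loc_wmap_rep => [a|t h r [e]|[a aS]|[a aS]].
- exact: chart_path.
- by apply: (@ideal_rel K (chart_alg R b)); exists e.
- by rewrite /= (set1P aS); case: b {aS}; exact: eqq_refl.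
- by rewrite /= (set1P aS); case: b {aS}; exact: eqq_refl.
Qed.

(** For the inverted arrow e and for e^-1, E F is 1 and the conjugate is e^-1 e; for
    the other arrows the two words are equal on the nose. *)
Lemma chart_retract b :
  retract (chart_E b) (chart_F b) (chart_gerbe b) (chart_gerbeV b).
Proof.
apply: retract_words => //.
- exact: chart_E_rep.
- exact: chart_F_rep.
- exact: gaugeP.
- case=> [a|[a aS]]; first exact: coord_word_contract.
  by move: (set1P aS); case: b a aS => [] [].
- by case.
- by move=> i; apply/eqP; case: b i => [] [[|[|[|//]]] ?].
- by case.
Qed.

(** * The overlap and the gluing *)

Definition conifold_chart b : chart A :=
  @retract_chart K A (chart_alg R b) _ _ _ _ _ (chart_retract b) tt
    unit_only.

Local Notation S12 := ([set gauge false] :|: [set gauge true]).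

Lemma gauge_overlap b : gauge b \in S12.
Proof. by rewrite !inE; case: b. Qed.

Lemma mem_overlap a : a \in S12 -> (a == ax) || (a == az).
Proof. by rewrite !inE. Qed.

Section Overlap.
Variable b : bool.
Local Notation B := (chart_alg R b).
Local Notation T := ([set cu] : {set arr B}).

(** As u is z and E(u) is x^-1 z in the first chart, u^-1 must be z^-1 x. *)
Definition overlap_E_word (i : @loc_arr K B T) : seq (@loc_arr K A S12) :=
  match i with
  | inl i => coord_word R (gauge_overlap b) i
  | inr _ => [:: inr (exist _ (gauge (~~ b)) (gauge_overlap (~~ b)));
                 inl (gauge b)]
  end.

Definition overlap_F_word (a : @loc_arr K A S12) : seq (@loc_arr K B T) :=
  match a with
  | inl a => [seq inl i | i <- contract b a]
  | inr a => if val a == gauge b then [::] else [:: inr (exist _ cu (set11 cu))]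
  end.

Definition overlap_E : qmap (loc (A := B) T) (loc (A := A) S12) :=
  wmap (A := loc (A := B) T) (B := loc (A := A) S12) (fun=> false) overlap_E_word.
Definition overlap_F : qmap (loc (A := A) S12) (loc (A := B) T) :=
  wmap (A := loc (A := A) S12) (B := loc (A := B) T) (fun=> tt) overlap_F_word.

Definition overlap_gerbe v := word K (gauge_inv R (gauge_overlap b) v).
Definition overlap_gerbeV v := word K (gauge_fwd R b S12 v).

End Overlap.

Lemma loc_chart_path b (t h : vert (loc (A := chart_alg R b) [set cu])) s :
  is_path t h s.
Proof.
exact: (one_vertex_path (A := loc (A := chart_alg R b) [set cu]) unit_only).
Qed.

Lemma overlap_E_rep b : is_rep (overlap_E b).
Proof.
apply: loc_wmap_rep => [[a|a]|t h _ [e ->]|[a aT]|[a aT]].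
- exact: coord_word_path.
- by case: b a.
- exact: ideal_coord.
- by apply: eqq_word; move: (set1P aT); case: b a aT => [] [[|[|[|//]]] ?].
- by apply: eqq_word; move: (set1P aT); case: b a aT => [] [[|[|[|//]]] ?].
Qed.

Lemma overlap_F_rep b : is_rep (overlap_F b).
Proof.
apply: loc_wmap_rep => [a|t h r [e]|[a aS]|[a aS]].
- exact: loc_chart_path.
- have -> : subst (fun a => word K (overlap_F_word b (inl a)))
      (cyclic_deriv e (conifold_potential R)) =
    subst (@loc_old K (chart_alg R b) [set cu]) (subst (fun a => word K (contract b a))
      (cyclic_deriv e (conifold_potential R))).
    apply: esym (etrans (subst_comp _ _ _) (eq_subst _ _)) => a.
    by apply: etrans (subst_word _ _ _) _; rewrite flatten_map1.
  by apply: ideal_rel; apply: LocOld; exists e.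
- apply: eqq_word; [exact: loc_chart_path|exact: loc_chart_path|].
  by move: (mem_overlap aS); case: b a aS => [] [].
- apply: eqq_word; [exact: loc_chart_path|exact: loc_chart_path|].
  by move: (mem_overlap aS); case: b a aS => [] [].
Qed.

Lemma overlap_retract b :
  retract (overlap_E b) (overlap_F b) (overlap_gerbe b) (overlap_gerbeV b).
Proof.
apply: retract_words => //.
- exact: overlap_E_rep.
- exact: overlap_F_rep.
- exact: gaugeP.
- case=> [a|[a aS]].
    by rewrite /= -map_comp; exact: coord_word_contract.
  by move: (mem_overlap aS); case: b a aS => [] [].
- by case.
- case=> [i|[i iT]]; apply/eqP; first by case: b i => [] [[|[|[|//]]] ?].
  by move: (set1P iT); case: b i iT => [] [[|[|[|//]]] ?].
- by case: b => [] [].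
Qed.

Definition overlap_alg := overlap (U1 := conifold_chart false)
  (U2 := conifold_chart true) ([set cu] : {set 'I_3}) ([set cu] : {set 'I_3}).

Definition glue_E (i : three) : qmap (overlap_alg i) (overlap_alg ch0) :=
  match i with
  | ch0 => qid _ | ch1 => overlap_E false | ch2 => overlap_E true
  end.
Definition glue_F (i : three) : qmap (overlap_alg ch0) (overlap_alg i) :=
  match i with
  | ch0 => qid _ | ch1 => overlap_F false | ch2 => overlap_F true
  end.
Definition glue_gerbe (i : three) : bool -> freealg K (@loc_arr K A S12) :=
  match i with
  | ch0 => fun=> 1 | ch1 => overlap_gerbe false | ch2 => overlap_gerbe true
  end.
Definition glue_gerbeV (i : three) : bool -> freealg K (@loc_arr K A S12) :=
  match i with
  | ch0 => fun=> 1 | ch1 => overlap_gerbeV false | ch2 => overlap_gerbeV true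
  end.

Lemma glue_retract i :
  retract (glue_E i) (glue_F i) (glue_gerbe i) (glue_gerbeV i).
Proof.
by case: i; [exact: retract_id | exact: overlap_retract | exact: overlap_retract].
Qed.

(** The maps F_i E_j with the identity factors removed, so that the comparisons of
    a chart with itself and of charts 1 and 2 have the prescribed form on the
    nose. *)
Definition glue_map (i j : three) : qmap (overlap_alg j) (overlap_alg i) :=
  match i, j with
  | ch0, ch0 => qid _ | ch1, ch1 => qid _ | ch2, ch2 => qid _
  | ch0, ch1 => overlap_E false | ch0, ch2 => overlap_E true
  | ch1, ch0 => overlap_F false | ch2, ch0 => overlap_F true
  | ch1, ch2 => qcomp (overlap_F false) (overlap_E true)
  | ch2, ch1 => qcomp (overlap_F true) (overlap_E false)
  end.

Lemma glue_rep i j : is_rep (glue_map i j).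
Proof.
case: i j => [] [].
- exact: qid_rep.
- exact: overlap_E_rep.
- exact: overlap_E_rep.
- exact: overlap_F_rep.
- exact: qid_rep.
- exact: qcomp_rep (overlap_F_rep _) (overlap_E_rep _).
- exact: overlap_F_rep.
- exact: qcomp_rep (overlap_F_rep _) (overlap_E_rep _).
- exact: qid_rep.
Qed.

Lemma glue_factor i j : eqmap (glue_map i j) (qcomp (glue_F i) (glue_E j)).
Proof.
case: i j => [] [].
- exact: eqmap_sym (retract_FE (glue_retract ch0)).
- exact: eqmap_idl.
- exact: eqmap_idl.
- exact: eqmap_idr.
- exact: eqmap_sym (retract_FE (glue_retract ch1)).
- exact: eqmap_refl.
- exact: eqmap_idr.
- exact: eqmap_refl.
- exact: eqmap_sym (retract_FE (glue_retract ch2)).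
Qed.

Definition conifold_stack : stack overlap_alg :=
  star_stack glue_retract glue_rep
    (fun i => match i with ch0 | ch1 | ch2 => erefl end) glue_factor.

Lemma restricts_conifold b (sS : [set gauge b] \subset S12)
    (d0 : bool -> freealg K (@loc_arr K A S12))
    (di : unit -> freealg K (@loc_arr K (chart_alg R b) [set cu])) :
    (forall v, d0 v = overlap_gerbe b v) -> (forall v, di v = 1) ->
  @restricts_chart K A (conifold_chart b) S12 sS [set cu]
    (overlap_E b) (overlap_F b) d0 di.
Proof.
move=> d0E diE; split.
- apply: eqmap_words => // i; rewrite /= [LHS]eval_wmap [RHS]eval_wmap.
  by congr word; apply/eqP; case: b sS {d0 di d0E diE} i => h [[|[|[|//]]] ?].
- apply: eqmap_words => // i; rewrite /= [LHS]eval_wmap [RHS]eval_wmap.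
  congr word; apply/eqP; case: i => [a|[a aS]].
    by case: b sS {d0 di d0E diE} a => h [].
  by move: (set1P aS); case: b sS {d0 di d0E diE} a aS => h [].
- move=> v; rewrite d0E [eval _ _]eval_wmap /overlap_gerbe.
  set s := flatten _; suff -> : s = gauge_inv R (gauge_overlap b) v.
    exact: eqq_refl.
  by apply/eqP; rewrite /s; case: b sS {d0 di d0E diE s} v => h [].
by move=> v; rewrite diE /= rmorph1; exact: eqq_refl.
Qed.

(** Transparent, because the reductions are computed from its transition maps. *)
Definition conifold_gluing :
  gluing (conifold_chart false) (conifold_chart true).
Proof.
apply: (@Gluing K A (conifold_chart false) (conifold_chart true)
  [set cu] [set cu] conifold_stack _ _ erefl erefl).
- apply: restricts_conifold => v; last by exact: rmorph1.
  exact: (@eval_id K (loc (A := A) S12) (overlap_gerbe false v)).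
- apply: restricts_conifold => v; last by exact: rmorph1.
  exact: (@eval_id K (loc (A := A) S12) (overlap_gerbe true v)).
Defined.

End Gluing.

(** * Noncommutativity *)

Section Specialization.
Variable R : realType.
Local Notation C := R[i].
Local Notation K := {mpoly C[2]}.

Definition contract_word b (s : seq conifold_arrow) : freealg K 'I_3 :=
  word K (flatten (map (contract b) s)).

Lemma chart_relE b e (t := conifold_terms e) :
  subst (fun a => word K (contract b a))
        (cyclic_deriv e (conifold_potential R)) =
  (1 + delta1 R) *: contract_word b t.1.1
  + (- (1 + delta2 R)) *: contract_word b t.1.2
  + (delta1 R - delta2 R) *: contract_word b [:: t.2].
Proof.
have substZ k s : subst (fun a => word K (contract b a)) (k *: word K s) =
    k *: contract_word b s.
  apply: etrans (subst_scalable _ _ _) _.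
  by congr (_ *: _); exact: subst_word.
have substD := raddfD (subst (fun a => word K (contract b a))).
rewrite conifold_derivE.
apply: etrans (substD _ _) (congr2 +%R (etrans (substD _ _) _) (substZ _ [:: _])).
by apply: etrans (congr2 +%R (substZ _ _) (substZ _ _)) _.
Qed.

Lemma chart_rel_morph b (S : nzRingType) (sigma : {rmorphism K -> S})
    (f : {rmorphism freealg K 'I_3 -> S}) e (t := conifold_terms e) :
    (forall k p, f (k *: p) = sigma k * f p) ->
  f (subst (fun a => word K (contract b a))
           (cyclic_deriv e (conifold_potential R))) =
  sigma (1 + delta1 R) * f (contract_word b t.1.1)
  - sigma (1 + delta2 R) * f (contract_word b t.1.2)
  + sigma (delta1 R - delta2 R) * f (contract_word b [:: t.2]).
Proof.
move=> fZ; rewrite chart_relE.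
apply: etrans (raddfD f _ _) (congr2 +%R (etrans (raddfD f _ _) _) (fZ _ _)).
apply: etrans (congr2 +%R (fZ _ _) (fZ _ _)) (congr1 (+%R _) _).
by rewrite (rmorphN sigma) mulNr.
Qed.

End Specialization.

Section Noncommutative.
Variable R : realType.
Local Notation C := R[i].
Local Notation K := {mpoly C[2]}.

Definition matrix_scalar : {rmorphism K -> 'M[C]_2} :=
  (@scalar_mx C 2) \o (meval (fun=> -1 : C)).

Definition matrix_letter (i : 'I_3) : 'M[C]_2 :=
  match val i with
  | 0 => 1
  | 1 => delta_mx ord0 ord_max
  | _ => delta_mx ord_max ord0
  end.

Lemma matrix_scalar_central k x : GRing.comm (matrix_scalar k) x.
Proof. exact: esym (scalar_mxC _ _). Qed.

(** At d1 = d2 = -1 both 1 + d1, 1 + d2 and d1 - d2 vanish, hence so do the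
    relations, and any assignment of matrices to the letters is a representation. *)
Definition matrix_rep : {rmorphism freealg K 'I_3 -> 'M[C]_2} :=
  lift_rmorphism matrix_letter matrix_scalar_central.

Lemma chart_noncommutative b :
  @noncommutative K (chart_alg R b) (tt : vert (chart_alg R b)).
Proof.
exists (gen K cy), (gen K cw); split.
- by move=> m _; exact: chart_path.
- by move=> m _; exact: chart_path.
move=> /(@ideal_morph K (chart_alg R b) _ matrix_rep) H.
have {}H : matrix_rep (gen K cy * gen K cw - gen K cw * gen K cy) = 0.
  apply: H => u v _ [e ->].
  rewrite (chart_rel_morph _ _ (sigma := matrix_scalar)); last exact: liftZ.
  have d0 d : d = delta1 R \/ d = delta2 R -> (d.@[fun=> -1] : C) = -1.
    by case=> ->; rewrite mevalXU.
  have s0 d : d = delta1 R \/ d = delta2 R -> matrix_scalar (1 + d) = 0.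
    move=> dE; rewrite /matrix_scalar /= mevalD meval1 d0 // subrr.
    exact: raddf0.
  have s1 : matrix_scalar (delta1 R - delta2 R) = 0.
    by rewrite /matrix_scalar /= mevalB !d0; [rewrite subrr raddf0|right|left].
  have sum0 (S : nzRingType) (k1 k2 k3 x y z : S) :
      k1 = 0 -> k2 = 0 -> k3 = 0 -> k1 * x - k2 * y + k3 * z = 0.
    by move=> -> -> ->; rewrite !mul0r subrr addr0.
  exact: sum0 (s0 _ (or_introl erefl)) (s0 _ (or_intror erefl)) s1.
have lw i j : matrix_rep (gen K i * gen K j) = matrix_letter i *m matrix_letter j.
  apply: etrans (rmorphM _ _ _) _.
  by congr (_ * _); exact: lift_gen.
have : matrix_letter cy *m matrix_letter cw -
    matrix_letter cw *m matrix_letter cy = 0.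
  exact: etrans (esym (etrans (raddfB _ _ _) (congr2 _ (lw _ _) (congr1 _ (lw _ _))))) H.
rewrite /matrix_letter /= mul_delta_mx mul_delta_mx => /matrixP /(_ ord0 ord0) /eqP.
by rewrite !mxE /= subr0 oner_eq0.
Qed.

End Noncommutative.

(** * The fibre at the origin *)

Section SpecialFibre.
Variable R : realType.
Local Notation C := R[i].
Local Notation K := {mpoly C[2]}.
Variables (A : qalg K) (pt : vert A).
Hypothesis pt_only : forall v : vert A, v = pt.
Local Notation A0 := (at0 A).

Lemma at0_between (t h : vert A0) p : between t h p.
Proof. exact: (one_vertex_between (A := A0) pt_only). Qed.

Definition at0_null (k : K) : Prop :=
  forall p, ideal (A := A0) pt pt (k *: p).

Lemma at0_null_delta (i : 'I_2) : at0_null 'X_i.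
Proof.
have null_alg d : ideal (A := A0) pt pt d%:A -> at0_null d.
  move=> id p; have := idealMr (@at0_between pt pt p) id.
  by rewrite mulr_algl.
have [->|->] : i = ord0 \/ i = ord_max.
- by case: i => [[|[|//]] ?]; [left|right]; exact: val_inj.
- by apply/null_alg/ideal_rel; exact: At0Delta1.
by apply/null_alg/ideal_rel; exact: At0Delta2.
Qed.

Lemma at0_nullD k l : at0_null k -> at0_null l -> at0_null (k + l).
Proof. by move=> nk nl p; rewrite scalerDl; apply: idealD. Qed.

Lemma at0_nullMl k l : at0_null l -> at0_null (k * l).
Proof. by move=> nl p; rewrite -scalerA; apply: idealZ. Qed.

Lemma at0_nullMr k l : at0_null k -> at0_null (k * l).
Proof. by move=> nk p; rewrite -scalerA; apply: nk. Qed.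

(** A polynomial in d1, d2 without constant term lies in the ideal (d1, d2).  The
    property is stable under products, so it is enough to know it for constants
    and variables. *)
Lemma at0_null_const (k : K) : at0_null (k - (k.@[fun=> 0] : C)%:MP).
Proof.
have null0 : at0_null 0 by move=> p; rewrite scale0r; exact: Ideal0.
have nullM k1 k2 : at0_null (k1 - (k1.@[fun=> 0] : C)%:MP) ->
    at0_null (k2 - (k2.@[fun=> 0] : C)%:MP) ->
    at0_null (k1 * k2 - ((k1 * k2).@[fun=> 0] : C)%:MP).
  move=> n1 n2; have -> : k1 * k2 - ((k1 * k2).@[fun=> 0] : C)%:MP =
      (k1 - (k1.@[fun=> 0] : C)%:MP) * k2
      + (k1.@[fun=> 0] : C)%:MP * (k2 - (k2.@[fun=> 0] : C)%:MP).
    by rewrite mevalM mpolyCM mulrBl mulrBr addrA subrK.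
  by apply: at0_nullD; [exact: at0_nullMr | exact: at0_nullMl].
have nullC (c : C) : at0_null (c%:MP - ((c%:MP_[2]).@[fun=> 0] : C)%:MP).
  by rewrite mevalC subrr.
elim/mpolyind: k => [|c m p _ _ IH]; first by rewrite meval0 mpolyC0 subrr.
rewrite mevalD mpolyCD opprD addrACA; apply: at0_nullD IH.
rewrite -mul_mpolyC; apply: (nullM); first exact: nullC.
rewrite mpolyXE_id.
apply: (big_ind (fun k : K => at0_null (k - (k.@[fun=> 0] : C)%:MP))) => [||i _].
- by rewrite -mpolyC1; exact: nullC.
- exact: nullM.
elim: (m i) => [|n IHn]; first by rewrite expr0 -mpolyC1; exact: nullC.
rewrite exprS; apply: nullM IHn.
by rewrite mevalXU mpolyC0 subr0; exact: at0_null_delta.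
Qed.

Lemma at0_scale k p : eqq (A := A0) pt pt (k *: p) ((k.@[fun=> 0] : C)%:MP *: p).
Proof. by rewrite /eqq -scalerBl; exact: at0_null_const. Qed.

End SpecialFibre.

Section NormalForm.
Variable K : comNzRingType.

Definition sorted_word n (m : 'X_{1..n}) : seq 'I_n :=
  flatten [seq nseq (m i) i | i <- enum 'I_n].

Lemma word_flatten (X : choiceType) (ss : seq (seq X)) :
  word K (flatten ss) = \prod_(s <- ss) word K s.
Proof.
elim: ss => [|s ss IH]; first by rewrite big_nil word_nil.
by rewrite big_cons -IH -word_cat.
Qed.

Lemma word_nseq (X : choiceType) (a : X) k : word K (nseq k a) = gen K a ^+ k.
Proof.
elim: k => [|k IH]; first by rewrite word_nil.
by rewrite exprS -IH -word_cons.
Qed.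

Lemma mmap1_gen n (m : 'X_{1..n}) :
  mmap1 (fun i => gen K i) m = word K (sorted_word m).
Proof.
rewrite word_flatten big_map enumT /mmap1.
by apply: eq_bigr => i _; rewrite word_nseq.
Qed.

Lemma count_sorted_word n (m : 'X_{1..n}) i :
  count_mem i (sorted_word m) = m i.
Proof.
rewrite count_flatten -map_comp sumnE big_map enumT /=.
rewrite (bigD1_seq i) ?mem_index_enum ?index_enum_uniq //=.
rewrite count_nseq /= eqxx mul1n big1 ?addn0 // => j ji.
by rewrite count_nseq /= (negbTE ji).
Qed.

Lemma mnm_sumU n (s : seq 'I_n) i : (\sum_(j <- s) U_(j))%MM i = count_mem i s.
Proof.
elim: s => [|j s IH]; first by rewrite big_nil mnm0E.
by rewrite big_cons mnmDE IH mnm1E.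
Qed.

Lemma sorted_wordK n (m : 'X_{1..n}) : (\sum_(i <- sorted_word m) U_(i))%MM = m.
Proof. by apply/mnmP => i; rewrite mnm_sumU count_sorted_word. Qed.

Lemma perm_sorted_word n (s : seq 'I_n) :
  perm_eq (sorted_word (\sum_(i <- s) U_(i))%MM) s.
Proof. by apply/allP => i _ /=; rewrite count_sorted_word mnm_sumU. Qed.

End NormalForm.

Section ChartReduction.
Variable R : realType.
Local Notation C := R[i].
Local Notation K := {mpoly C[2]}.
Local Notation poly3 := {mpoly C[3]}.

Definition constant_term : {rmorphism K -> poly3} :=
  @mpolyC 3 C \o meval (fun=> 0 : C).

Definition chart_reduction : {rmorphism freealg K 'I_3 -> poly3} :=
  lift_rmorphism (sigma := constant_term) (fun i => 'X_i : poly3)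
    (fun k x => mulrC _ x).

(** The products of [mmap1] are ordered, so monomials are lifted to ordered words. *)
Definition chart_section (q : poly3) : freealg K 'I_3 :=
  mpoly.mmap (in_alg (freealg K 'I_3) \o @mpolyC 2 C) (fun i => gen K i) q.

Lemma chart_reduction_word s :
  chart_reduction (word K s) = 'X_[(\sum_(i <- s) U_(i))%MM].
Proof. by apply: etrans (lift_word _ _ _) _; rewrite mprodXE. Qed.

Lemma chart_reductionZ k p :
  chart_reduction (k *: p) = (k.@[fun=> 0])%:MP * chart_reduction p.
Proof. exact: liftZ. Qed.

Lemma chart_reductionD p q :
  chart_reduction (p + q) = chart_reduction p + chart_reduction q.
Proof. exact: (raddfD chart_reduction). Qed.

Lemma chart_reduction0 : chart_reduction 0 = 0.
Proof. exact: (raddf0 chart_reduction). Qed.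

Lemma chart_sectionD p q : chart_section (p + q) = chart_section p + chart_section q.
Proof. exact: mpoly.mmapD. Qed.

Lemma chart_section0 : chart_section 0 = 0.
Proof. exact: mpoly.mmap0. Qed.

Lemma chart_sectionZ c q : chart_section (c *: q) = c%:MP *: chart_section q.
Proof. by apply: etrans (mpoly.mmapZ _ _ _ _) _; rewrite /= mulr_algl. Qed.

Lemma chart_sectionX m : chart_section 'X_[m] = word K (sorted_word m).
Proof. by apply: etrans (mpoly.mmapX _ _ _) (mmap1_gen _ _). Qed.

Lemma chart_sectionK q : chart_reduction (chart_section q) = q.
Proof.
elim/mpolyind: q => [|c m q _ _ IH].
  by rewrite chart_section0 chart_reduction0.
rewrite chart_sectionD chart_reductionD; congr (_ + _); last exact: IH.
rewrite chart_sectionZ chart_reductionZ chart_sectionX chart_reduction_word.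
by rewrite mevalC mul_mpolyC sorted_wordK.
Qed.

Section Fibre.
Variable b : bool.
Local Notation B := (chart_alg R b).
Local Notation B0 := (at0 B).
Let B_only : forall v : vert B, v = tt := unit_only.

(** Modulo d1 and d2 only the two monomials with coefficients 1 + d1 and
    -(1 + d2) survive in a relation. *)
Lemma at0_commuting e (t := conifold_terms e) :
  eqq (A := B0) tt tt (contract_word R b t.1.1) (contract_word R b t.1.2).
Proof.
have null d : d = delta1 R \/ d = delta2 R -> at0_null (tt : vert B) d.
  by case=> ->; exact: at0_null_delta B_only _.
have rel : ideal (A := B0) tt tt (subst (fun a => word K (contract b a))
             (cyclic_deriv e (conifold_potential R))).
  by apply: ideal_rel; apply: At0Old; exists e.
rewrite chart_relE in rel; rewrite -/t in rel.
set p := contract_word R b t.1.1 in rel *; set q := contract_word R b t.1.2 in rel *.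
have modZ d x : d = delta1 R \/ d = delta2 R ->
    eqq (A := B0) tt tt ((1 + d) *: x) x.
  by move=> dE; rewrite /eqq scalerDl scale1r addrC addKr; exact: null.
have l0 x : ideal (A := B0) tt tt (- ((delta1 R - delta2 R) *: x)).
  apply: idealN; rewrite scalerBl; apply: idealD; first by apply: null; left.
  by apply: idealN; apply: null; right.
have pq : eqq (A := B0) tt tt ((1 + delta1 R) *: p) ((1 + delta2 R) *: q).
  have := idealD rel (l0 (contract_word R b [:: t.2])).
  by rewrite addrK scaleNr; apply.
apply: eqq_trans (eqq_sym (modZ _ p (or_introl erefl))) _.
exact: eqq_trans pq (modZ _ q (or_intror erefl)).
Qed.

End Fibre.

Local Notation fibre b := (at0 (chart_alg R b)).

(** With the inverted arrow removed, three of the four derivatives of Phi become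
    the three commutators of u, y, w. *)
Lemma at0_yw b : eqq (A := fibre b) tt tt (word K [:: cy; cw]) (word K [:: cw; cy]).
Proof.
by case: b; [exact: (at0_commuting true ax) | exact: eqq_sym (at0_commuting false az)].
Qed.

Lemma at0_uw b : eqq (A := fibre b) tt tt (word K [:: cu; cw]) (word K [:: cw; cu]).
Proof.
by case: b; [exact: eqq_sym (at0_commuting true ay) | exact: (at0_commuting false ay)].
Qed.

Lemma at0_uy b : eqq (A := fibre b) tt tt (word K [:: cu; cy]) (word K [:: cy; cu]).
Proof.
by case: b; [exact: (at0_commuting true aw) | exact: eqq_sym (at0_commuting false aw)].
Qed.

Lemma at0_letters b (i j : 'I_3) :
  eqq (A := fibre b) tt tt (word K [:: i; j]) (word K [:: j; i]).
Proof.
have letter k : [\/ k = cu, k = cy | k = cw].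
  by case: k => [[|[|[|//]]] ?]; [constructor 1|constructor 2|constructor 3];
    exact: val_inj.
case: (letter i) (letter j) => -> [] ->.
- exact: eqq_refl.
- exact: at0_uy.
- exact: at0_uw.
- exact: eqq_sym (at0_uy b).
- exact: eqq_refl.
- exact: at0_yw.
- exact: eqq_sym (at0_uw b).
- exact: eqq_sym (at0_yw b).
- exact: eqq_refl.
Qed.

Section Fibre.
Variable b : bool.
Local Notation B := (chart_alg R b).
Local Notation B0 := (at0 B).
Let B_only : forall v : vert B, v = tt := unit_only.

(** Sorting the letters of a word is allowed in the fibre, so the fibre is spanned
    by the ordered words; this makes the reduction injective on it. *)
Lemma chart_normal_form p :
  eqq (A := B0) tt tt (chart_section (chart_reduction p)) p.
Proof.
elim/free_ind: p => [|k s p IH].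
  rewrite chart_reduction0 chart_section0; exact: eqq_refl.
rewrite chart_reductionD chart_sectionD.
apply: eqqD IH; rewrite chart_reductionZ mul_mpolyC chart_sectionZ.
rewrite chart_reduction_word chart_sectionX.
apply: eqq_trans (eqq_sym (at0_scale B_only k _)) _; apply: eqqZ.
exact: (word_perm (A := B0) B_only (at0_letters b) (perm_sorted_word s)).
Qed.

Lemma chart_reduction_rel u v r :
  rels_at0 (A := B) u v r -> chart_reduction r = 0.
Proof.
have deltaE d : d = delta1 R \/ d = delta2 R -> (d.@[fun=> 0] : C) = 0.
  by case=> ->; rewrite mevalXU.
have sum0 (S : nzRingType) (k1 k2 k3 x y z : S) :
    k1 = 1 -> k2 = 1 -> k3 = 0 -> x = y -> k1 * x - k2 * y + k3 * z = 0.
  by move=> -> -> -> ->; rewrite mul0r subrr addr0.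
case=> [{u v r} u v _ [e ->]|{}v|{}v]; last 2 first.
- by rewrite chart_reductionZ deltaE ?mpolyC0 ?mul0r //; left.
- by rewrite chart_reductionZ deltaE ?mpolyC0 ?mul0r //; right.
rewrite (chart_rel_morph _ _ (sigma := constant_term)); last exact: liftZ.
apply: sum0.
- by rewrite /constant_term /= mevalD meval1 deltaE ?addr0 //; left.
- by rewrite /constant_term /= mevalD meval1 deltaE ?addr0 //; right.
- by rewrite /constant_term /= mevalB !deltaE ?subr0 ?mpolyC0 //; [right|left].
rewrite chart_reduction_word chart_reduction_word; congr 'X_[_].
by apply: perm_big; case: (b) e => [] [].
Qed.

Lemma chart_reduces : @reduces_to_C3 R B tt chart_reduction.
Proof.
split=> [k p|q|p]; first exact: chart_reductionZ.
  by split=> // _; exists (chart_section q); exact: chart_sectionK.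
split=> [p0|]; last exact:
  (@ideal_morph K B0 _ chart_reduction tt tt p chart_reduction_rel).
have := chart_normal_form p; rewrite p0 chart_section0.
by move/eqq_sym; rewrite /eqq subr0.
Qed.

End Fibre.

End ChartReduction.

(** * The overlap at the origin *)

Section OverlapReduction.
Variables (R : realType) (b : bool).
Local Notation C := R[i].
Local Notation K := {mpoly C[2]}.
Local Notation poly3 := {mpoly C[3]}.
Local Notation frac3 := {fraction poly3}.
Local Notation B := (chart_alg R b).
Local Notation L := (loc (A := B) [set cu]).
Local Notation L0 := (at0 L).
Local Notation larr := (@loc_arr K B [set cu]).
Local Notation old := (eval (@to_loc K B [set cu])).

Definition overlap_scalar : {rmorphism K -> frac3} :=
  @tofrac poly3 \o constant_term R.

Definition overlap_letter (a : larr) : frac3 :=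
  match a with
  | inl i => tofrac ('X_i : poly3)
  | inr _ => (tofrac ('X_ord0 : poly3))^-1
  end.

Definition overlap_reduction : {rmorphism freealg K larr -> frac3} :=
  lift_rmorphism (sigma := overlap_scalar) overlap_letter (fun k x => mulrC _ x).

Lemma overlap_reductionZ k p : overlap_reduction (k *: p) =
  tofrac ((k.@[fun=> 0] : C)%:MP : poly3) * overlap_reduction p.
Proof. exact: liftZ. Qed.

Lemma overlap_reductionM p q :
  overlap_reduction (p * q) = overlap_reduction p * overlap_reduction q.
Proof. exact: (rmorphM overlap_reduction). Qed.

Lemma overlap_reduction_word s :
  overlap_reduction (word K s) = \prod_(a <- s) overlap_letter a.
Proof. exact: lift_word. Qed.

Lemma overlap_reduction_gen a : overlap_reduction (gen K a) = overlap_letter a.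
Proof. exact: lift_gen. Qed.

Lemma overlap_reduction_old p :
  overlap_reduction (old p) = tofrac (chart_reduction R p).
Proof.
apply: (free_rmorph_eq (phi := overlap_reduction \o old)
  (psi := @tofrac poly3 \o chart_reduction R) (sigma := overlap_scalar)).
- move=> k q; apply: etrans (congr1 overlap_reduction _) (overlap_reductionZ _ _).
  exact: subst_scalable.
- move=> k q; apply: etrans (congr1 (@tofrac poly3) (chart_reductionZ _ _)) _.
  exact: tofracM.
move=> a; apply: etrans (congr1 overlap_reduction (eval_gen (@to_loc K B [set cu]) a)) _.
apply: etrans (overlap_reduction_gen (inl a)) _; apply: esym.
exact: (congr1 (@tofrac poly3) (lift_gen _ _ a)).
Qed.

Lemma X0_frac_neq0 : tofrac ('X_ord0 : poly3) != 0.
Proof. by rewrite tofrac_eq0 -msupp_eq0 msuppX. Qed.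

Lemma overlap_reduction_rel u v r :
  rels_at0 (A := L) u v r -> overlap_reduction r = 0.
Proof.
have word_gen (a c : larr) : overlap_letter a * overlap_letter c = 1 ->
    overlap_reduction (gen K a * gen K c - 1) = 0.
  move=> ac; rewrite gen2_word -word_nil.
  apply: etrans (raddfB overlap_reduction _ _) _.
  apply: etrans (congr2 (fun x y => x - y) (overlap_reduction_word _)
                       (overlap_reduction_word _)) _.
  by rewrite big_cons big_seq1 big_nil ac subrr.
case=> [{u v r} u v _ [{}u {}v r ru|[i iT]|[i iT]]|{}v|{}v].
- rewrite [overlap_reduction _]overlap_reduction_old.
  by rewrite (chart_reduction_rel (At0Old ru)) tofrac0.
- apply: word_gen; rewrite /overlap_letter /= (set1P iT).
  by rewrite divff // X0_frac_neq0.
- apply: word_gen; rewrite /overlap_letter /= (set1P iT).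
  by rewrite mulVf // X0_frac_neq0.
- by rewrite overlap_reductionZ mevalXU mpolyC0 tofrac0 mul0r.
by rewrite overlap_reductionZ mevalXU mpolyC0 tofrac0 mul0r.
Qed.

Let L_only : forall v : vert L, v = tt := unit_only.
Let btw (t h : vert L0) p : between t h p.
Proof. exact: at0_between L_only _ _ _. Qed.

Lemma fibre_to_loc p : ideal (A := at0 B) tt tt p -> ideal (A := L0) tt tt (old p).
Proof.
pose f : qmap (at0 B) L0 := @QMap K (at0 B) L0 id (fun a => gen K (inl a : larr)).
suff f_rep : is_rep f by exact: (eval_ideal f_rep).
split=> [a|u v r ru]; first exact: btw.
apply: ideal_rel; case: ru => [{}u {}v {}r ru|{}v|{}v].
- by apply: At0Old; apply: LocOld.
- suff -> : eval f (delta1 R)%:A = (delta1 R)%:A by exact: At0Delta1.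
  by apply: etrans (subst_scalable _ _ _) _; rewrite rmorph1.
suff -> : eval f (delta2 R)%:A = (delta2 R)%:A by exact: At0Delta2.
by apply: etrans (subst_scalable _ _ _) _; rewrite rmorph1.
Qed.

Lemma fibre_to_loc_eqq p q :
  eqq (A := at0 B) tt tt p q -> eqq (A := L0) tt tt (old p) (old q).
Proof. by move/fibre_to_loc; rewrite raddfB. Qed.

Definition upow n : freealg K larr := word K (nseq n (inl cu : larr)).
Definition uinv : larr := inr (exist _ cu (set11 cu)).

Lemma upow0 : upow 0 = 1.
Proof. exact: word_nil. Qed.

Lemma upowD m n : upow (m + n)%N = upow m * upow n.
Proof. by rewrite /upow nseqD word_cat. Qed.

Lemma old_word s : old (word K s) = word K (map inl s).
Proof. by apply: etrans (subst_word _ _ _) _; rewrite flatten_map1. Qed.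

Lemma old_upow n : old (word K (nseq n cu)) = upow n.
Proof. by rewrite old_word map_nseq. Qed.

Lemma upow_comm n i :
  eqq (A := L0) tt tt (upow n * gen K (inl i : larr)) (gen K (inl i : larr) * upow n).
Proof.
have := word_swap (A := at0 B) L_only (at0_letters R b) (nseq n cu) [:: i].
move/fibre_to_loc_eqq; rewrite old_word old_word map_cat map_cat map_nseq.
by rewrite word_cat word_cat.
Qed.

Lemma uinv_mul : eqq (A := L0) tt tt (gen K uinv * gen K (inl cu : larr)) 1.
Proof.
apply: ideal_rel; apply: At0Old.
exact: (@LocInvL _ B [set cu] (exist _ cu (set11 cu))).
Qed.

Lemma mul_uinv a : eqq (A := L0) tt tt (gen K (inl cu : larr) * gen K (inr a : larr)) 1.
Proof.
apply: ideal_rel; apply: At0Old; have := @LocInvR _ B [set cu] a.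
by case: a => i iT /=; rewrite {1}(set1P iT).
Qed.

(** Powers of u move to the right across the other letters until they meet a
    letter u^-1. *)
Lemma clear_denominators_word s :
  exists n q, eqq (A := L0) tt tt (upow n * word K s) (old q).
Proof.
elim: s => [|[i|a] s [n [q nq]]].
- exists 0%N, 1; rewrite upow0 mul1r word_nil rmorph1; exact: eqq_refl.
- exists n, (gen K i * q); rewrite word_cons mulrA.
  apply: eqq_trans (eqqMr (@btw _ _ _) (upow_comm n i)) _.
  rewrite -mulrA rmorphM /= eval_gen; exact: eqqMl (@btw _ _ _) nq.
exists n.+1, q; rewrite word_cons -(addn1 n) upowD -mulrA.
apply: eqq_trans (eqqMl (@btw tt tt (upow n)) _) nq; rewrite mulrA.
rewrite -[X in eqq _ _ _ X]mul1r.
exact: eqqMr (@btw tt tt (word K s)) (mul_uinv a).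
Qed.

Lemma clear_denominators p :
  exists n q, eqq (A := L0) tt tt (upow n * p) (old q).
Proof.
elim/free_ind: p => [|k s p [n [q nq]]].
  by exists 0%N, 0; rewrite mulr0 raddf0; exact: eqq_refl.
have [m [r mr]] := clear_denominators_word s.
exists (m + n)%N, (k *: (word K (nseq n cu) * r) + word K (nseq m cu) * q).
rewrite mulrDr raddfD /=; apply: eqqD.
  rewrite -free_scalerAr [old _]linearZ /= addnC upowD -mulrA; apply: eqqZ.
  rewrite rmorphM /= old_upow; exact: eqqMl (@btw _ _ _) mr.
rewrite upowD -mulrA rmorphM /= old_upow; exact: eqqMl (@btw _ _ _) nq.
Qed.

Lemma uinv_upow n :
  eqq (A := L0) tt tt (word K (nseq n uinv) * upow n) 1.
Proof.
elim: n => [|n IH]; first by rewrite upow0 mulr1 word_nil; exact: eqq_refl.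
have -> : upow n.+1 = gen K (inl cu : larr) * upow n by exact: word_cons.
rewrite -(addn1 n) nseqD word_cat -mulrA [X in _ * X]mulrA.
apply: eqq_trans _ IH; apply: eqqMl (@btw tt tt _) _.
rewrite -[X in eqq _ _ _ X]mul1r; exact: eqqMr (@btw tt tt _) uinv_mul.
Qed.

Lemma overlap_reduction_upow n :
  overlap_reduction (upow n) = tofrac ('X_ord0 : poly3) ^+ n.
Proof. by rewrite overlap_reduction_word big_nseq -Monoid.iteropE. Qed.

Lemma overlap_reduction_ideal p :
  ideal (A := L0) tt tt p -> overlap_reduction p = 0.
Proof. exact: (@ideal_morph K L0 _ overlap_reduction tt tt p overlap_reduction_rel). Qed.

(** If p reduces to 0, then so does u^n p, which comes from the chart and thus
    vanishes in the fibre; as u is invertible, p does too. *)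
Lemma overlap_reduces : reduces_to_overlap (A := L) tt overlap_reduction.
Proof.
have cleared p : exists n q, eqq (A := L0) tt tt (upow n * p) (old q) /\
    tofrac ('X_ord0 : poly3) ^+ n * overlap_reduction p = tofrac (chart_reduction R q).
  have [n [q nq]] := clear_denominators p; exists n, q; split=> //.
  rewrite -overlap_reduction_upow -overlap_reductionM -overlap_reduction_old.
  apply/eqP; rewrite -subr_eq0; apply/eqP.
  exact: etrans (esym (raddfB overlap_reduction _ _)) (overlap_reduction_ideal nq).
have Xn0 n : tofrac ('X_ord0 : poly3) ^+ n != 0 by rewrite expf_neq0 // X0_frac_neq0.
split=> [k p|y|p]; first exact: overlap_reductionZ.
- split=> [[q [n ->]]|[p <-]].
    exists (word K (nseq n uinv) * old (chart_section q)).
    rewrite overlap_reductionM overlap_reduction_old chart_sectionK.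
    rewrite overlap_reduction_word big_nseq -Monoid.iteropE.
    by rewrite -[overlap_letter uinv]/((tofrac ('X_ord0 : poly3))^-1) [LHS]mulrC -exprVn.
  have [n [q [_ nq]]] := cleared p; exists (chart_reduction R q), n.
  by rewrite -nq mulrC mulKf.
split=> [p0|]; last exact: overlap_reduction_ideal.
have [n [q [e nq]]] := cleared p.
move: nq; rewrite p0 mulr0 => /esym/eqP; rewrite tofrac_eq0 => /eqP q0.
have [_ _ /(_ q)/proj1/(_ q0)/fibre_to_loc iq] := chart_reduces R b.
apply: (@ideal_eqq K L0 tt tt p (word K (nseq n uinv) * upow n * p)).
  rewrite -[X in eqq _ _ X _]mul1r.
  exact: eqq_sym (eqqMr (@btw tt tt p) (uinv_upow n)).
rewrite -mulrA; exact: idealMl (@btw tt tt _) (ideal_eqq e iq).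
Qed.

End OverlapReduction.

(** * The transition map at the origin *)

Section Transition.
Variable R : realType.
Local Notation C := R[i].
Local Notation K := {mpoly C[2]}.
Local Notation poly3 := {mpoly C[3]}.
Local Notation frac3 := {fraction poly3}.

Definition transition_morph : {rmorphism poly3 -> frac3} :=
  mpoly.mmap (@tofrac poly3 \o @mpolyC 3 C) (@std_coord R).

(** The transition map sends u to z^-1 x = u^-1 and y, w to y z = y u and
    w z = w u (with x and z exchanged for the opposite direction). *)
Lemma transition_letter b (i : 'I_3) :
  \prod_(a <- flatten (map (overlap_F_word (R := R) b)
                           (overlap_E_word (R := R) (b := ~~ b) (inl i))))
    overlap_letter a = std_coord R i.
Proof.
have XX j : std_coord R j = if j == ord0 then (tofrac ('X_ord0 : poly3))^-1
    else tofrac ('X_j : poly3) * tofrac ('X_ord0 : poly3).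
  by rewrite /std_coord; case: ifP => // _; rewrite mulrC tofracM.
rewrite XX; case: b; case: i => [[|[|[|//]]] Hi];
  by rewrite /= ?big_cons ?big_nil /= ?mulr1.
Qed.

Lemma transition_reduction b p :
  overlap_reduction R b (eval (qcomp (overlap_F R b) (overlap_E R (~~ b)))
                            (eval (@to_loc K (chart_alg R (~~ b)) [set cu]) p)) =
  std_transition (chart_reduction R p).
Proof.
pose f := eval (qcomp (overlap_F R b) (overlap_E R (~~ b))).
pose old := eval (@to_loc K (chart_alg R (~~ b)) [set cu]).
apply: (free_rmorph_eq (phi := overlap_reduction R b \o (f \o old))
  (psi := transition_morph \o chart_reduction R) (sigma := overlap_scalar R)).
- move=> k q; apply: etrans (congr1 (overlap_reduction R b) _) (overlap_reductionZ _ _).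
  by apply: etrans (congr1 f (subst_scalable _ k q)) _; exact: subst_scalable.
- move=> k q; apply: etrans (congr1 transition_morph (chart_reductionZ _ _)) _.
  apply: etrans (rmorphM transition_morph _ _) _.
  by apply: congr2 => //; exact: mpoly.mmapC.
move=> i.
have E : overlap_reduction R b (f (old (gen K i))) =
    overlap_reduction R b (word K (flatten (map (overlap_F_word (R := R) b)
      (overlap_E_word (R := R) (b := ~~ b) (inl i))))).
  apply: (congr1 (overlap_reduction R b)).
  apply: etrans (congr1 f (eval_gen (@to_loc K (chart_alg R (~~ b)) [set cu]) i)) _.
  apply: etrans (eval_comp _ _ _) _.
  apply: etrans (congr1 (eval (overlap_F R b)) (eval_gen (overlap_E R (~~ b)) (inl i))) _.
  exact: eval_wmap.
apply: etrans E _; apply: etrans (overlap_reduction_word _) _.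
apply: etrans (transition_letter _ _) _.
apply: esym; apply: etrans (congr1 transition_morph (lift_gen _ _ i)) _.
by apply: etrans (mpoly.mmapX _ _ _) _; rewrite mmap1U.
Qed.

Lemma conifold_deformation : deformation_resolved_conifold (conifold_gluing R).
Proof.
split; [exact: chart_noncommutative | exact: chart_noncommutative |].
exists (chart_reduction R), (chart_reduction R).
exists (overlap_reduction R false), (overlap_reduction R true).
split; first split.
- exact: chart_reduces.
- exact: chart_reduces.
- exact: overlap_reduces.
- exact: overlap_reduces.
- exact: overlap_reduction_old.
- exact: overlap_reduction_old.
- exact: (@transition_reduction false).
exact: (@transition_reduction true).
Qed.

Lemma conifold_chart_deformation b : deformation_C3 (conifold_chart R b).
Proof.
split; first exact: chart_noncommutative.
by exists (chart_reduction R); exact: chart_reduces.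
Qed.

End Transition.

Theorem lemma7p17 (R : realType) :
  exists (U1 U2 : chart (conifold R)) (g : gluing U1 U2),
    [/\ deformation_resolved_conifold g, deformation_C3 U1 & deformation_C3 U2].
Proof.
exists (conifold_chart R false), (conifold_chart R true), (conifold_gluing R).
split; first exact: conifold_deformation.
  exact: conifold_chart_deformation.
exact: conifold_chart_deformation.
Qed.
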